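(* Consider a consistent elementary-probability environment given by event symbols $A_1,\dots,A_n$, boolean combinations $B_1,\dots,B_k$ of them and finitely many polynomial requirements $g_r(P(B_1),\dots,P(B_k))\triangleleft_r 0$, $r\in R$, and let $$g_{|R|+1}(P(B_1),\dots,P(B_k))\triangleleft 0\qquad(\ast)$$ be a further elementary probability relation ($g_{|R|+1}$ a real polynomial in $k$ variables, $\triangleleft\in\{=,\neq,\ge\}$). For $\alpha\in\{-1,1\}^n$ put $A^\alpha=\bigcap_{i=1}^nA_i^{\alpha_i}$ with $A_i^1=A_i$, $A_i^{-1}=A_i^c$; let $\Sigma_j\subseteq\{-1,1\}^n$ be such that $B_j=\bigcup_{\alpha\in\Sigma_j}A^\alpha$, and put $x_j(\mathbf y)=\sum_{\alpha\in\Sigma_j}y_\alpha$ for $\mathbf y=(y_\alpha)_{\alpha\in\{-1,1\}^n}$. Then $(\ast)$ is a necessary consequence of the probability environment if and only if the system $$g_r(x_1(\mathbf y),\dots,x_k(\mathbf y))\triangleleft_r0\ (r\in R),\qquad \sum_{\alpha}y_\alpha=1,\qquad y_\alpha\ge0\ \text{ for all }\alpha,$$ augmented by the negation of the relation $g_{|R|+1}(x_1(\mathbf y),\dots,x_k(\mathbf y))\triangleleft 0$, admits no real solution $\mathbf y$. Consequently, whether $(\ast)$ is a necessary consequence is decidable.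
   Context: A basic probability space is a triple $(\overline\Omega,\overline{\mathbb A},\overline P)$ where $\overline\Omega$ is a set, $\overline{\mathbb A}$ is a family of subsets of $\overline\Omega$ containing $\emptyset$ and $\overline\Omega$, and $\overline P:\overline{\mathbb A}\to\mathbb R$ satisfies $\overline P(\emptyset)=0$, $\overline P(\overline\Omega)=1$, and $\overline P(\overline A)\le\overline P(\overline B)$ whenever $\overline A\subseteq\overline B$ are in $\overline{\mathbb A}$. In an elementary-probability environment, $R$ is finite, each $g_r$ is a real polynomial in $k$ variables and $\triangleleft_r\in\{=,\neq,\ge\}$; in addition all finite collections of events are required to be jointly perceivable, i.e. the family of events is an algebra and $P$ is finitely additive on it. A model is a basic probability space $(\overline\Omega,\overline{\mathbb A},\overline P)$ with $\overline{\mathbb A}$ an algebra and $\overline P$ finitely additive, together with events $\overline A_1,\dots,\overline A_n\in\overline{\mathbb A}$, such that $g_r(\overline P(\overline B_1),\dots,\overline P(\overline B_k))\triangleleft_r0$ for all $r\in R$, where $\overline B_j$ is $B_j$ evaluated at $\overline A_1,\dots,\overline A_n$. The environment is consistent if it has a model. A statement is a necessary consequence if it holds in all models. Since coefficients are real numbers, ''decidable'' is meant in the sense of Tarski-Seidenberg elimination: there is a procedure that decides the question in finitely many steps, the steps being arithmetic operations and sign tests on the coefficients. *)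

(* Defs.v *)
From mathcomp Require Import all_boot all_order all_algebra.
From mathcomp Require Import all_classical all_reals.
(* The notations of mpoly are incompatible with those of classical_sets. *)
From mathcomp Require Import -(notations) mpoly.

Set Implicit Arguments.
Unset Strict Implicit.
Unset Printing Implicit Defensive.

Import Order.TTheory GRing.Theory Num.Theory.

Local Open Scope classical_set_scope.
Local Open Scope ring_scope.

(* The probability is a total function on subsets; its values outside the
   family F are irrelevant, since nothing below ever refers to them. *)
Record basic_probability_space (R : realType) (T : Type)
    (F : set (set T)) (P : set T -> R) : Prop := {
  bps_event0 : F set0;
  bps_eventT : F setT;
  bps_prob0 : P set0 = 0;
  bps_probT : P setT = 1;
  bps_prob_le : forall A B, F A -> F B -> A `<=` B -> P A <= P B
}.

Definition closed_under_complement (T : Type) (F : set (set T)) : Prop :=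
  forall A, F A -> F (~` A).

Definition finitely_additive_on (R : realType) (T : Type)
    (F : set (set T)) (P : set T -> R) : Prop :=
  forall A B, F A -> F B -> A `&` B = set0 -> P (A `|` B) = P A + P B.

Inductive bool_comb (n : nat) : Type :=
| Atom of 'I_n
| Compl of bool_comb n
| Union of bool_comb n & bool_comb n
| Inter of bool_comb n & bool_comb n.

Fixpoint event_of (n : nat) (T : Type) (A : 'I_n -> set T)
    (b : bool_comb n) : set T :=
  match b with
  | Atom i => A i
  | Compl b1 => ~` event_of A b1
  | Union b1 b2 => event_of A b1 `|` event_of A b2
  | Inter b1 b2 => event_of A b1 `&` event_of A b2
  end.

Inductive comparison_symbol : Type := EqZero | NeqZero | GeZero.

Definition holds (R : realType) (s : comparison_symbol) (x : R) : Prop :=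
  match s with
  | EqZero => x = 0
  | NeqZero => x <> 0
  | GeZero => 0 <= x
  end.

Record prob_relation (R : realType) (k : nat) : Type := Relation {
  rel_poly : mpoly k R;
  rel_symbol : comparison_symbol
}.

Definition satisfies (R : realType) (k : nat) (x : 'I_k -> R)
    (r : prob_relation R k) : Prop :=
  holds (rel_symbol r) (meval x (rel_poly r)).

(* The finite index set of the requirements is 'I_(num_requirements). *)
Record environment (R : realType) (n k : nat) : Type := Environment {
  combs : 'I_k -> bool_comb n;
  num_requirements : nat;
  requirement : 'I_num_requirements -> prob_relation R k
}.

Section Environments.
Variables (R : realType) (n k : nat) (E : environment R n k).

Definition comb_prob (T : Type) (P : set T -> R) (A : 'I_n -> set T) :
    'I_k -> R :=
  fun j => P (event_of A (combs E j)).

Record is_model (T : Type) (F : set (set T)) (P : set T -> R)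
    (A : 'I_n -> set T) : Prop := {
  model_bps : basic_probability_space F P;
  model_setU : setU_closed F;
  model_setC : closed_under_complement F;
  model_additive : finitely_additive_on F P;
  model_event : forall i, F (A i);
  model_requirements :
    forall r : 'I_(num_requirements E),
      satisfies (comb_prob P A) (requirement r)
}.

Definition consistent : Prop :=
  exists (T : Type) (F : set (set T)) (P : set T -> R) (A : 'I_n -> set T),
    is_model F P A.

Definition necessary_consequence (r : prob_relation R k) : Prop :=
  forall (T : Type) (F : set (set T)) (P : set T -> R) (A : 'I_n -> set T),
    is_model F P A -> satisfies (comb_prob P A) r.

End Environments.

(* {-1, 1}^n, with true for 1 and false for -1. *)
Notation signs n := {ffun 'I_n -> bool}.

Definition sign_atom (n : nat) (T : Type) (A : 'I_n -> set T)
    (a : signs n) : set T :=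
  \bigcap_(i in setT) (if a i then A i else ~` A i).

(* The equality b = U_(a in S) A^a is an identity between boolean expressions
   in the event symbols: it is required under every interpretation of them. *)
Definition union_of_atoms (n : nat) (b : bool_comb n) (S : {set signs n}) :
    Prop :=
  forall (T : Type) (A : 'I_n -> set T),
    event_of A b = \bigcup_(a in [set` S]) sign_atom A a.

Definition atom_sum (R : realType) (n k : nat) (S : 'I_k -> {set signs n})
    (y : signs n -> R) : 'I_k -> R :=
  fun j => \sum_(a in S j) y a.

(* Procedures with arithmetic over R: untyped call-by-value functional programs
   over lists and real numbers. They treat real numbers as opaque: the only
   operations on them are +, -, *, / and sign tests, and the only constants
   available to a program are 0 and 1. In particular one program is a finite
   object that does not depend on R.
   Variables are de Bruijn indices; in EFun e, index 0 is the argument and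
   index 1 is the function itself, so that functions may be recursive. *)
Inductive program : Type :=
| EVar of nat
| EFun of program
| EApp of program & program
| ENil
| EPair of program & program
| EFst of program
| ESnd of program
| EIfNil of program & program & program
| EZero
| EOne
| EAdd of program & program
| ESub of program & program
| EMul of program & program
| EDiv of program & program
| EIfSign of program & program & program & program.

Inductive value (R : Type) : Type :=
| VNil
| VNum of R
| VPair of value R & value R
| VClosure of seq (value R) & program.

Arguments VNil {R}.

(* run env e v: in the environment env, the program e terminates (after the
   finitely many steps recorded by the derivation) with result v. There is no
   rule for ill-typed operations or for divisions by 0. *)
Inductive run (R : realType) : seq (value R) -> program -> value R -> Prop :=
| run_Var env i v : onth env i = Some v -> run env (EVar i) v
| run_Fun env e : run env (EFun e) (VClosure env e)
| run_App env e1 e2 env' e w v :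
    run env e1 (VClosure env' e) -> run env e2 w ->
    run [:: w, VClosure env' e & env'] e v ->
    run env (EApp e1 e2) v
| run_Nil env : run env ENil VNil
| run_Pair env e1 e2 v1 v2 :
    run env e1 v1 -> run env e2 v2 -> run env (EPair e1 e2) (VPair v1 v2)
| run_Fst env e v1 v2 : run env e (VPair v1 v2) -> run env (EFst e) v1
| run_Snd env e v1 v2 : run env e (VPair v1 v2) -> run env (ESnd e) v2
| run_IfNil_nil env e e1 e2 v :
    run env e VNil -> run env e1 v -> run env (EIfNil e e1 e2) v
| run_IfNil_pair env e e1 e2 w1 w2 v :
    run env e (VPair w1 w2) -> run env e2 v -> run env (EIfNil e e1 e2) v
| run_Zero env : run env EZero (VNum 0)
| run_One env : run env EOne (VNum 1)
| run_Add env e1 e2 x1 x2 :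
    run env e1 (VNum x1) -> run env e2 (VNum x2) ->
    run env (EAdd e1 e2) (VNum (x1 + x2))
| run_Sub env e1 e2 x1 x2 :
    run env e1 (VNum x1) -> run env e2 (VNum x2) ->
    run env (ESub e1 e2) (VNum (x1 - x2))
| run_Mul env e1 e2 x1 x2 :
    run env e1 (VNum x1) -> run env e2 (VNum x2) ->
    run env (EMul e1 e2) (VNum (x1 * x2))
| run_Div env e1 e2 x1 x2 :
    run env e1 (VNum x1) -> run env e2 (VNum x2) -> x2 != 0 ->
    run env (EDiv e1 e2) (VNum (x1 / x2))
| run_IfSign_neg env e e1 e2 e3 x v :
    run env e (VNum x) -> x < 0 -> run env e1 v -> run env (EIfSign e e1 e2 e3) v
| run_IfSign_zero env e e1 e2 e3 x v :
    run env e (VNum x) -> x = 0 -> run env e2 v -> run env (EIfSign e e1 e2 e3) v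
| run_IfSign_pos env e e1 e2 e3 x v :
    run env e (VNum x) -> 0 < x -> run env e3 v ->
    run env (EIfSign e e1 e2 e3) v.

Lemma run_deterministic (R : realType) (env : seq (value R)) e v w :
  run env e v -> run env e w -> v = w.
Proof.
move=> H; elim: H w => {env e v}; intros;
  match goal with
  | Hr : run _ _ ?w |- _ = ?w => inversion Hr; clear Hr; subst
  end;
  repeat match goal with
  | IH : forall w, run ?env ?e w -> _ = w, Hr : run ?env ?e _ |- _ =>
      have {Hr} := IH _ Hr; (move=> [? ?] || move=> [?] || move=> ?); subst
  end => //; try congruence;
  match goal with
  | H1 : is_true _, H2 : is_true _ |- _ =>
      by move: (lt_trans H1 H2); rewrite ltxx
  | H1 : is_true _ |- _ => by move: H1; rewrite ltxx
  end.
Qed.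

Section Encoding.
Variable R : realType.

Definition enc_seq (s : seq (value R)) : value R := foldr (@VPair R) VNil s.

Definition enc_nat (m : nat) : value R := enc_seq (nseq m VNil).

Fixpoint enc_bool_comb (n : nat) (b : bool_comb n) : value R :=
  match b with
  | Atom i => VPair (enc_nat 0) (enc_nat i)
  | Compl b1 => VPair (enc_nat 1) (enc_bool_comb b1)
  | Union b1 b2 =>
      VPair (enc_nat 2) (VPair (enc_bool_comb b1) (enc_bool_comb b2))
  | Inter b1 b2 =>
      VPair (enc_nat 3) (VPair (enc_bool_comb b1) (enc_bool_comb b2))
  end.

Definition enc_poly (k : nat) (p : mpoly k R) : value R :=
  enc_seq [seq VPair (VNum (mcoeff m p))
                     (enc_seq [seq enc_nat (m i) | i <- enum 'I_k])
          | m <- msupp p].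

Definition enc_symbol (s : comparison_symbol) : value R :=
  match s with
  | EqZero => enc_nat 0
  | NeqZero => enc_nat 1
  | GeZero => enc_nat 2
  end.

Definition enc_relation (k : nat) (r : prob_relation R k) : value R :=
  VPair (enc_symbol (rel_symbol r)) (enc_poly (rel_poly r)).

Definition enc_problem (n k : nat) (E : environment R n k)
    (r : prob_relation R k) : value R :=
  enc_seq [:: enc_nat n; enc_nat k;
    enc_seq [seq enc_bool_comb (combs E j) | j <- enum 'I_k];
    enc_seq [seq enc_relation (requirement i)
            | i <- enum 'I_(num_requirements E)];
    enc_relation r].

Definition answers (p : program) (input : value R) (Q : Prop) : Prop :=
  (Q -> run [:: input] p (VNum 1)) /\ (~ Q -> run [:: input] p (VNum 0)).

End Encoding.

(* Main.v *)
Require Import Defs.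
From mathcomp Require Import all_boot all_order all_algebra.
From mathcomp Require Import all_classical all_reals.
From mathcomp Require Import -(notations) mpoly.
From mathcomp Require Import polyorder polyrcf qe_rcf_th.

Set Implicit Arguments.
Unset Strict Implicit.
Unset Printing Implicit Defensive.

Import Order.TTheory GRing.Theory Num.Theory.

Local Open Scope ring_scope.

(* A model is determined, as far as the B_j are concerned, by the numbers
   y_a = P(A^a): they are nonnegative, have sum 1, and P(B_j) = x_j(y) by finite
   additivity. Conversely a solution y is the weight function of a probability on
   all subsets of {-1,1}^n, with A_i the set of sign vectors whose i-th
   coordinate is 1.

   For decidability, the variables y_a are eliminated one at a time from a
   disjunction of systems p_1 = ... = p_l = 0 < q_1, ..., q_m. For one variable
   the equations amount to P = p_1^2 + ... + p_l^2 = 0, and the number of roots of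
   P where all q_j are positive is, up to the factor 2^m, the sum over
   e in {1,2}^m of the Tarski queries of P and q_1^e_1 ... q_m^e_m: each factor
   sgn(q_j) + sgn(q_j)^2 is 2 if q_j > 0 and 0 otherwise. A Tarski query is a
   Cauchy index, computed by signed pseudo-remainders. The coefficients being
   polynomials in the other variables, every sign test on them branches, and the
   tests made along the successful branches are the systems in the remaining
   variables. *)

(** * Functions computed by programs *)

Class encodable (R : Type) (A : Type) := enc : A -> value R.

Section Encodings.
Variable R : realType.

#[global] Instance encodable_num : encodable R R := @VNum R.
#[global] Instance encodable_nat : encodable R nat := @enc_nat R.
(** [false] is coded by [VNil] and [true] by a pair, so [EIfNil] branches on booleans. *)
#[global] Instance encodable_bool : encodable R bool := fun b => enc_nat R b.
#[global] Instance encodable_unit : encodable R unit := fun=> VNil.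
#[global] Instance encodable_prod A B {_ : encodable R A} {_ : encodable R B} :
  encodable R (A * B) := fun p => VPair (enc p.1) (enc p.2).
#[global] Instance encodable_seq A {_ : encodable R A} : encodable R (seq A) :=
  fun s => enc_seq [seq enc a | a <- s].

End Encodings.

Section Computability.
Variable R : realType.
Implicit Types (rho : seq (value R)) (o : seq (option (value R))).

(* [None] marks an entry of the environment about which nothing is known. *)
Fixpoint fits o rho : Prop :=
  match o, rho with
  | [::], _ => True
  | None :: o', _ :: rho' => fits o' rho'
  | Some v :: o', w :: rho' => v = w /\ fits o' rho'
  | _ :: _, [::] => False
  end.

Lemma fits_onth o rho i v :
  fits o rho -> nth None o i = Some v -> onth rho i = Some v.
Proof.
elim: o rho i => [|[a|] o IH] [|w rho] [|i] //=.
- by case=> -> _ [->].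
- by case=> _; apply: IH.
- exact: IH.
Qed.

(* The program e is uniform in x; env x lists what is known about the
   environment in which e is run. *)
Definition computable (X A : Type) {EA : encodable R A}
    (env : X -> seq (option (value R))) (f : X -> A) : Prop :=
  exists e, forall x rho, fits (env x) rho -> run rho e (enc (f x)).

(** * Rules for the constructs of the language *)

Section Rules.
Variables (X : Type) (env : X -> seq (option (value R))).

Lemma computable_var (A : Type) {EA : encodable R A} (f : X -> A) i :
  (forall x, nth None (env x) i = Some (enc (f x))) -> computable env f.
Proof.
by move=> H; exists (EVar i) => x rho /fits_onth h; apply: run_Var; apply: h.
Qed.

Lemma computable_ext (A : Type) {EA : encodable R A} (f g : X -> A) :
  f =1 g -> computable env f -> computable env g.
Proof. by move=> fg [e He]; exists e => x rho; rewrite -fg; apply: He. Qed.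

Lemma computable_fst (A B : Type) {EA : encodable R A} {EB : encodable R B}
    (f : X -> A * B) : computable env f -> computable env (fun x => (f x).1).
Proof.
by move=> [e He]; exists (EFst e) => x rho h; exact: run_Fst (He _ _ h).
Qed.

Lemma computable_snd (A B : Type) {EA : encodable R A} {EB : encodable R B}
    (f : X -> A * B) : computable env f -> computable env (fun x => (f x).2).
Proof.
by move=> [e He]; exists (ESnd e) => x rho h; exact: run_Snd (He _ _ h).
Qed.

Lemma computable_pair (A B : Type) {EA : encodable R A} {EB : encodable R B}
    (f : X -> A) (g : X -> B) : computable env f -> computable env g ->
  computable env (fun x => (f x, g x)).
Proof.
move=> [e He] [e' He']; exists (EPair e e') => x rho h.
by apply: run_Pair; [apply: He | apply: He'].
Qed.

(** A call extends the environment by the argument and, at index 1, the closure itself; nothing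
    needs to be known about the latter. *)
Lemma computable_let (A B : Type) {EA : encodable R A} {EB : encodable R B}
    (a : X -> A) (F : X -> A -> B) :
  computable env a ->
  computable (fun y : X * A => [:: Some (enc y.2), None & env y.1])
             (fun y => F y.1 y.2) ->
  computable env (fun x => F x (a x)).
Proof.
move=> [e He] [e' He']; exists (EApp (EFun e') e) => x rho h.
apply: run_App; [exact: run_Fun | exact: (He _ _ h)|].
exact: (He' (x, a x)).
Qed.

Lemma computable_nil (A : Type) {EA : encodable R A} :
  computable env (fun _ => [::] : seq A).
Proof. by exists ENil => x rho _; apply: run_Nil. Qed.

Lemma computable_cons (A : Type) {EA : encodable R A} (f : X -> A)
    (g : X -> seq A) : computable env f -> computable env g ->
  computable env (fun x => f x :: g x).
Proof.
move=> [e He] [e' He']; exists (EPair e e') => x rho h.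
by apply: run_Pair; [apply: He | apply: He'].
Qed.

Lemma computable_O : computable env (fun _ => 0%N).
Proof. by exists ENil => x rho _; apply: run_Nil. Qed.

Lemma computable_S (f : X -> nat) :
  computable env f -> computable env (fun x => (f x).+1).
Proof.
move=> [e He]; exists (EPair ENil e) => x rho h.
by apply: run_Pair; [apply: run_Nil | apply: He].
Qed.

Lemma computable_false : computable env (fun _ => false).
Proof. by exists ENil => x rho _; apply: run_Nil. Qed.

Lemma computable_true : computable env (fun _ => true).
Proof. by exists (EPair ENil ENil) => x rho h; apply: run_Pair; apply: run_Nil. Qed.

Lemma computable_0 : computable env (fun _ => 0 : R).
Proof. by exists EZero => x rho _; apply: run_Zero. Qed.

Lemma computable_1 : computable env (fun _ => 1 : R).
Proof. by exists EOne => x rho _; apply: run_One. Qed.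

Lemma computable_add (f g : X -> R) :
  computable env f -> computable env g -> computable env (fun x => f x + g x).
Proof.
move=> [e He] [e' He']; exists (EAdd e e') => x rho h.
by apply: run_Add; [apply: He | apply: He'].
Qed.

Lemma computable_mul (f g : X -> R) :
  computable env f -> computable env g -> computable env (fun x => f x * g x).
Proof.
move=> [e He] [e' He']; exists (EMul e e') => x rho h.
by apply: run_Mul; [apply: He | apply: He'].
Qed.

Lemma computable_opp (f : X -> R) :
  computable env f -> computable env (fun x => - f x).
Proof.
move=> [e He]; exists (ESub EZero e) => x rho h; rewrite -sub0r.
by apply: run_Sub; [apply: run_Zero | apply: He].
Qed.

Lemma computable_gt0 (f : X -> R) :
  computable env f -> computable env (fun x => 0 < f x).
Proof.
move=> [e He]; exists (EIfSign e ENil ENil (EPair ENil ENil)) => x rho h.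
have := He _ _ h; case: (ltrgtP 0 (f x)) => fx /= He'.
- by apply: run_IfSign_pos fx _ => //; apply: run_Pair; apply: run_Nil.
- by apply: run_IfSign_neg fx _ => //; apply: run_Nil.
- by apply: run_IfSign_zero (esym fx) _ => //; apply: run_Nil.
Qed.

Lemma computable_if (A : Type) {EA : encodable R A} (b : X -> bool)
    (f g : X -> A) : computable env b -> computable env f -> computable env g ->
  computable env (fun x => if b x then f x else g x).
Proof.
move=> [e He] [e1 He1] [e2 He2]; exists (EIfNil e e2 e1) => x rho h.
have := He _ _ h; rewrite /enc /encodable_bool; case: (b x) => He'.
- by apply: run_IfNil_pair He' _; apply: He1.
- by apply: run_IfNil_nil He' _; apply: He2.
Qed.

(** Three nested calls bind the list, its head and its tail. The new [None] entries are the list and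
    the three closures. *)
Lemma computable_seq_case (A B : Type) {EA : encodable R A}
    {EB : encodable R B} (s : X -> seq A) (z : X -> B)
    (F : X -> A -> seq A -> B) :
  computable env s -> computable (fun x => [:: None, None & env x]) z ->
  computable (fun y : X * A * seq A =>
    [:: Some (enc y.2), None, Some (enc y.1.2), None, None, None & env y.1.1])
    (fun y => F y.1.1 y.1.2 y.2) ->
  computable env (fun x => if s x is a :: t then F x a t else z x).
Proof.
move=> [es Hs] [ez Hz] [eF HF].
exists (EApp (EFun (EIfNil (EVar 0) ez
  (EApp (EFun (EApp (EFun eF) (ESnd (EVar 2)))) (EFst (EVar 0))))) es).
move=> x rho h; apply: run_App; [exact: run_Fun | exact: (Hs _ _ h)|].
case: (s x) => [|a t]; first by apply: run_IfNil_nil; [exact: run_Var | exact: Hz].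
apply: run_IfNil_pair; first by apply: run_Var.
apply: run_App; [exact: run_Fun | by apply: run_Fst; exact: run_Var |].
apply: run_App; [exact: run_Fun | by apply: run_Snd; exact: run_Var |].
exact: (HF (x, a, t)).
Qed.

Lemma computable_foldr (A B : Type) {EA : encodable R A} {EB : encodable R B}
    (F : X -> A -> B -> B) (z : X -> B) (s : X -> seq A) :
  computable env s -> computable (fun x => [:: None, None & env x]) z ->
  computable (fun y : X * A * B =>
    [:: Some (enc y.2), None, Some (enc y.1.2), None, None, None & env y.1.1])
    (fun y => F y.1.1 y.1.2 y.2) ->
  computable env (fun x => foldr (F x) (z x) (s x)).
Proof.
move=> [es Hs] [ez Hz] [eF HF].
(* Where [EVar 3] is evaluated, the entries are the head, a closure, the list and the closure of
   [body], so this is the recursive call on the tail. *)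
pose body := EIfNil (EVar 0) ez
  (EApp (EFun (EApp (EFun eF) (EApp (EVar 3) (ESnd (EVar 2))))) (EFst (EVar 0))).
exists (EApp (EFun body) es) => x rho h.
apply: run_App; [exact: run_Fun | exact: (Hs _ _ h)|].
elim: (s x) => [|a t IH].
  by apply: run_IfNil_nil; [exact: run_Var | exact: Hz].
apply: run_IfNil_pair; first by apply: run_Var.
apply: run_App; [exact: run_Fun | by apply: run_Fst; exact: run_Var |].
apply: run_App; [exact: run_Fun | |].
  apply: run_App; [exact: run_Var | by apply: run_Snd; exact: run_Var |].
  exact: IH.
exact: (HF (x, a, foldr (F x) (z x) t)).
Qed.

(** A natural number has the same code as the list of that many [tt], so the program for [n] serves
    unchanged. This turns numbers into lists to fold over. *)
Lemma computable_nseq (n : X -> nat) :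
  computable env n -> computable env (fun x => nseq (n x) tt).
Proof.
by move=> [e He]; exists e => x rho /He; rewrite /enc/= /encodable_seq map_nseq.
Qed.

End Rules.
End Computability.

Ltac find_entry l v k :=
  lazymatch l with
  | Some (enc ?w) :: ?l' =>
      tryif unify w v then k 0%N else find_entry l' v ltac:(fun n => k (S n))
  | _ :: ?l' => find_entry l' v ltac:(fun n => k (S n))
  end.

Ltac computable_lookup :=
  eapply computable_var; let x := fresh in intro x; cbv beta;
  lazymatch goal with |- nth _ ?l _ = Some (enc ?v) =>
    find_entry l v ltac:(fun n => exact (erefl : nth None l n = Some (enc v))) end.

Section Functions.
Variable R : realType.

(** The arguments of a named function come as one tuple in an environment of one entry. Being
    classes, these statements are found by resolution once a function is known to be computable. *)
Class computable1 (A B : Type) {EA : encodable R A} {EB : encodable R B}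
    (f : A -> B) :=
  computable1P : computable (fun a => [:: Some (enc a)]) f.

Class computable2 (A B C : Type) {EA : encodable R A} {EB : encodable R B}
    {EC : encodable R C} (f : A -> B -> C) :=
  computable2P : computable (fun a => [:: Some (enc a)]) (fun a => f a.1 a.2).

Class computable3 (A B C D : Type) {EA : encodable R A} {EB : encodable R B}
    {EC : encodable R C} {ED : encodable R D} (f : A -> B -> C -> D) :=
  computable3P :
    computable (fun a => [:: Some (enc a)]) (fun a => f a.1.1 a.1.2 a.2).

Class computable4 (A B C D E : Type) {EA : encodable R A} {EB : encodable R B}
    {EC : encodable R C} {ED : encodable R D} {EE : encodable R E}
    (f : A -> B -> C -> D -> E) :=
  computable4P :
    computable (fun a => [:: Some (enc a)]) (fun a => f a.1.1.1 a.1.1.2 a.1.2 a.2).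

Lemma computable_app1 X env (A B : Type) {EA : encodable R A}
    {EB : encodable R B} (f : A -> B) {Hf : computable1 f} (a : X -> A) :
  computable env a -> computable env (fun x => f (a x)).
Proof.
move=> Ha; apply: (computable_let (F := fun _ => f)) => //.
by have [e He] := Hf; exists e => -[x y] [|w rho] //= [<- _]; apply: He.
Qed.

Lemma computable_app2 X env (A B C : Type) {EA : encodable R A}
    {EB : encodable R B} {EC : encodable R C}
    (f : A -> B -> C) {Hf : computable2 f} (a : X -> A) (b : X -> B) :
  computable env a -> computable env b -> computable env (fun x => f (a x) (b x)).
Proof.
move=> Ha Hb; apply: (computable_app1 (a := fun x => (a x, b x)) (Hf := Hf)).
exact: computable_pair.
Qed.

Lemma computable_app3 X env (A B C D : Type) {EA : encodable R A}
    {EB : encodable R B} {EC : encodable R C} {ED : encodable R D}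
    (f : A -> B -> C -> D) {Hf : computable3 f}
    (a : X -> A) (b : X -> B) (c : X -> C) :
  computable env a -> computable env b -> computable env c ->
  computable env (fun x => f (a x) (b x) (c x)).
Proof.
move=> Ha Hb Hc; apply: (computable_app1 (a := fun x => (a x, b x, c x)) (Hf := Hf)).
by apply: computable_pair => //; apply: computable_pair.
Qed.

Lemma computable_app4 X env (A B C D E : Type) {EA : encodable R A}
    {EB : encodable R B} {EC : encodable R C} {ED : encodable R D}
    {EE : encodable R E}
    (f : A -> B -> C -> D -> E) {Hf : computable4 f}
    (a : X -> A) (b : X -> B) (c : X -> C) (d : X -> D) :
  computable env a -> computable env b -> computable env c -> computable env d ->
  computable env (fun x => f (a x) (b x) (c x) (d x)).
Proof.
move=> Ha Hb Hc Hd.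
apply: (computable_app1 (a := fun x => (a x, b x, c x, d x)) (Hf := Hf)).
by apply: computable_pair => //; apply: computable_pair => //; apply: computable_pair.
Qed.

End Functions.

(* Redefined below as rules for further functionals become available. *)
Ltac computable_binder := fail.

Ltac computable_eta :=
  lazymatch goal with
  | |- computable _ (fun _ => _) => idtac
  | |- @computable ?R ?X ?A ?EA ?env ?f =>
      change (@computable R X A EA env (fun x => f x))
  end.

(** The rules are directed by the head symbol of the function, so repeating them builds the program
    from the definition. Projections are first sought in the environment, where bound variables are
    stored. *)
Ltac computable_step :=
  computable_eta;
  lazymatch goal with
  | |- computable _ (fun x => x) => computable_lookup
  | |- computable _ (fun x => fst (@?f x)) =>
      first [computable_lookup | refine (computable_fst _)]
  | |- computable _ (fun x => snd (@?f x)) =>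
      first [computable_lookup | refine (computable_snd _)]
  | |- computable _ (fun x => (_, _)) => refine (computable_pair _ _)
  | |- computable _ (fun x => [::]) => exact: computable_nil
  | |- computable _ (fun x => _ :: _) => refine (computable_cons _ _)
  | |- computable _ (fun x => true) => exact: computable_true
  | |- computable _ (fun x => false) => exact: computable_false
  | |- computable _ (fun x => O) => exact: computable_O
  | |- computable _ (fun x => S _) => refine (computable_S _)
  | |- computable _ (fun x => 0%R) => exact: computable_0
  | |- computable _ (fun x => 1%R) => exact: computable_1
  | |- computable _ (fun x => (_ + _)%R) => refine (computable_add _ _)
  | |- computable _ (fun x => (- _)%R) => refine (computable_opp _)
  | |- computable _ (fun x => (_ * _)%R) => refine (computable_mul _ _)
  | |- computable _ (fun x => (0 < _)%R) => refine (computable_gt0 _)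
  | |- computable _ (fun x => if _ then _ else _) =>
      refine (computable_if _ _ _)
  | |- computable _ (fun x => match _ with [::] => _ | _ :: _ => _ end) =>
      refine (computable_seq_case _ _ _)
  | |- computable _ (fun x => foldr _ _ _) => refine (computable_foldr _ _ _)
  | |- computable _ (fun x => nseq _ tt) => refine (computable_nseq _)
  | _ => first [ computable_binder
    | lazymatch goal with
      | |- @computable ?R _ _ _ _ (fun x => ?f (@?a x) (@?b x) (@?c x) (@?d x)) =>
             let H := constr:(computable4P (R := R) (f := f)) in
             refine (computable_app4 (Hf := H) _ _ _ _)
      end
    | lazymatch goal with
      | |- @computable ?R _ _ _ _ (fun x => ?f (@?a x) (@?b x) (@?c x)) =>
             let H := constr:(computable3P (R := R) (f := f)) in
             refine (computable_app3 (Hf := H) _ _ _)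
      end
    | lazymatch goal with
      | |- @computable ?R _ _ _ _ (fun x => ?f (@?a x) (@?b x)) =>
             let H := constr:(computable2P (R := R) (f := f)) in
             refine (computable_app2 (Hf := H) _ _)
      end
    | lazymatch goal with
      | |- @computable ?R _ _ _ _ (fun x => ?f (@?a x)) =>
             let H := constr:(computable1P (R := R) (f := f)) in
             refine (computable_app1 (Hf := H) _)
      end ]
  end; cbv beta.

Ltac unfold_head f :=
  lazymatch f with
  | ?g _ => unfold_head g
  | _ => try unfold f
  end.

Ltac computable_tac :=
  lazymatch goal with
  | |- computable1 ?f => red; computable_eta; unfold_head f
  | |- computable2 ?f => red; unfold_head f
  | |- computable3 ?f => red; unfold_head f
  | |- computable4 ?f => red; unfold_head f
  | |- _ => idtac
  end; repeat computable_step.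

(** * Programs for lists, numbers and booleans *)

Section Library.
Variable R : realType.

Section Binders.
Variables (X : Type) (env : X -> seq (option (value R))).

Lemma computable_map (A B : Type) {EA : encodable R A} {EB : encodable R B}
    (F : X -> A -> B) (s : X -> seq A) :
  computable env s ->
  computable (fun y : X * A * seq B =>
    [:: None, None, Some (enc y.1.2), None, None, None & env y.1.1])
    (fun y => F y.1.1 y.1.2) ->
  computable env (fun x => [seq F x a | a <- s x]).
Proof.
move=> Hs [e He].
have : computable env (fun x => foldr (fun a r => F x a :: r) [::] (s x)).
  apply: computable_foldr => //; first exact: computable_nil.
  refine (computable_cons _ _); last by computable_tac.
  exists e => y [|w rho] //= [_ h].
  exact: (He y (w :: rho)).
apply: computable_ext => x; elim: (s x) => //= a t -> //.
Qed.

(** Iteration is a fold over [n] copies of [tt]. *)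
Lemma computable_iter (A : Type) {EA : encodable R A} (F : X -> A -> A)
    (z : X -> A) (n : X -> nat) :
  computable env n -> computable (fun x => [:: None, None & env x]) z ->
  computable (fun y : X * unit * A =>
    [:: Some (enc y.2), None, None, None, None, None & env y.1.1])
    (fun y => F y.1.1 y.2) ->
  computable env (fun x => iter (n x) (F x) (z x)).
Proof.
move=> Hn Hz [e He].
have : computable env (fun x => foldr (fun _ => F x) (z x) (nseq (n x) tt)).
  refine (computable_foldr _ Hz _); first exact: computable_nseq.
  exists e => y rho h; apply: He.
  by case: rho h => [|? [|? [|? rho]]] //= [-> []].
by apply: computable_ext => x; elim: (n x) => //= m ->.
Qed.

End Binders.

Ltac computable_binder ::=
  lazymatch goal with
  | |- computable _ (fun x => map _ _) => refine (computable_map _ _)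
  | |- computable _ (fun x => iter _ _ _) => refine (computable_iter _ _ _)
  end.

#[global] Instance computable_cat (A : Type) {EA : encodable R A} :
  computable2 (@cat A).
Proof.
red; apply: (computable_ext (f := fun a : seq A * seq A => foldr cons a.2 a.1)).
  by case=> s t /=; elim: s => //= a s ->.
computable_tac.
Qed.

#[global] Instance computable_flatten (A : Type) {EA : encodable R A} :
  computable1 (@flatten A).
Proof. computable_tac. Qed.

#[global] Instance computable_size (A : Type) {EA : encodable R A} :
  computable1 (@size A).
Proof.
red; apply: (computable_ext (f := foldr (fun (_ : A) n => n.+1) 0%N)).
  by elim=> //= a s ->.
computable_tac.
Qed.

#[global] Instance computable_behead (A : Type) {EA : encodable R A} :
  computable1 (@behead A).
Proof. computable_tac. Qed.

#[global] Instance computable_head (A : Type) {EA : encodable R A} :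
  computable2 (@head A).
Proof. computable_tac. Qed.

#[global] Instance computable_nth (A : Type) {EA : encodable R A} :
  computable3 (@nth A).
Proof.
red; apply: (computable_ext
  (f := fun a : A * seq A * nat => head a.1.1 (iter a.2 behead a.1.2))).
  case=> -[z s] i /=; suff ->: iter i behead s = drop i s.
    by rewrite -nth0 nth_drop addn0.
  by elim: i => [|i IH]; rewrite ?drop0 //= IH -drop1 drop_drop.
computable_tac.
Qed.

#[global] Instance computable_pred : computable1 (R := R) predn.
Proof.
red; apply: (computable_ext (f := fun n => size (behead (nseq n tt)))).
  by case=> //= n; rewrite size_nseq.
computable_tac.
Qed.

#[global] Instance computable_addn : computable2 (R := R) addn.
Proof.
red; apply: (computable_ext (f := fun a : nat * nat => iter a.1 S a.2)).
  by case=> m n /=; elim: m => //= m ->.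
computable_tac.
Qed.

#[global] Instance computable_subn : computable2 (R := R) subn.
Proof.
red; apply: (computable_ext (f := fun a : nat * nat => iter a.2 predn a.1)).
  by case=> m n /=; elim: n => [|n IH]; rewrite ?subn0 //= IH subnS.
computable_tac.
Qed.

#[global] Instance computable_leq : computable2 (R := R) leq.
Proof.
red; apply: (computable_ext (f := fun a : nat * nat =>
  if nseq (a.1 - a.2) tt is [::] then true else false)).
  by case=> m n /=; rewrite /leq; case: (m - n)%N.
computable_tac.
Qed.

#[global] Instance computable_negb : computable1 (R := R) negb.
Proof. computable_tac. Qed.

#[global] Instance computable_andb : computable2 (R := R) andb.
Proof. computable_tac. Qed.

#[global] Instance computable_eqn : computable2 (R := R) (@eq_op nat).
Proof.
red; apply: (computable_ext
  (f := fun a : nat * nat => (a.1 <= a.2)%N && (a.2 <= a.1)%N)).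
  by case=> m n /=; rewrite eqn_leq.
computable_tac.
Qed.

#[global] Instance computable_odd : computable1 (R := R) odd.
Proof.
red; apply: (computable_ext (f := fun n => iter n negb false)).
  by elim=> //= n ->.
computable_tac.
Qed.

#[global] Instance computable_iota : computable2 (R := R) iota.
Proof.
red; apply: (computable_ext
  (f := fun a : nat * nat => iter a.2 (fun l => a.1 :: [seq i.+1 | i <- l]) [::])).
  case=> m n /=; elim: n => //= n ->; congr cons.
  by rewrite -[m.+1]add1n iotaDl.
computable_tac.
Qed.

#[global] Instance computable_eq_seq_bool : computable2 (R := R) (@eq_op (seq bool)).
Proof.
red; apply: (computable_ext (f := fun a : seq bool * seq bool =>
  (size a.1 == size a.2) &&
  foldr (fun i b => (if nth false a.1 i then nth false a.2 i
                     else ~~ nth false a.2 i) && b) true (iota 0 (size a.1)))).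
  case=> s t /=; have [eq_st|neq_st] := eqVneq (size s) (size t); last first.
    by apply/esym/negbTE; apply: contra_neq neq_st => ->.
  transitivity (all (fun i => nth false s i == nth false t i) (iota 0 (size s))).
    by rewrite /=; elim: iota => //= i l ->; case: nth; case: nth.
  apply/allP/eqP => [H|-> //]; apply: (@eq_from_nth _ false) => // i lt_i.
  by apply/eqP/H; rewrite mem_iota.
computable_tac.
Qed.

End Library.

(** * The elimination procedure *)

(** The variables y_a are named by their sign vectors a, written as lists of booleans. *)
Local Notation var := (seq bool).
(* Sums of monomials c * v_1 * ... * v_d, the word v_1 ... v_d listing the
   variables with multiplicity. *)
Local Notation mp R := (seq (R * seq var)).
(* Univariate polynomials over mp R, constant term first. *)
Local Notation up R := (seq (mp R)).
(* (p, true) stands for p > 0 and (p, false) for p = 0. *)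
Local Notation conditions R := (seq (mp R * bool)).
(* A computation that branches on sign tests: the possible results, each with
   the conditions under which it is reached. *)
Local Notation branching R A := (seq (conditions R * A)).

(** The number of event symbols is packed into the data, so that one type, and hence one program,
    serves all n. *)
Local Notation comb_code := {n : nat & bool_comb n}.
Local Notation relation_code R := (nat * seq (R * seq nat))%type.
Local Notation problem_code R := (nat * (nat * (seq comb_code *
  (seq (relation_code R) * (relation_code R * unit)))))%type.

Section Procedure.
Variable R : realType.

Definition ret (A : Type) (a : A) : branching R A := [:: ([::], a)].

Definition bind (A B : Type) (m : branching R A) (F : A -> branching R B) :
    branching R B :=
  flatten [seq [seq (b.1 ++ c.1, c.2) | c <- F b.2] | b <- m].

Definition mp_opp (p : mp R) : mp R := [seq (- t.1, t.2) | t <- p].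

Definition mp_mul (p q : mp R) : mp R :=
  flatten [seq [seq (s.1 * t.1, s.2 ++ t.2) | t <- q] | s <- p].

Definition mp_one : mp R := [:: (1, [::])].

Definition up_add (p q : up R) : up R :=
  [seq nth [::] p i ++ nth [::] q i | i <- iota 0 (size p + size q)].

Definition up_scale (c : mp R) (p : up R) : up R := [seq mp_mul c a | a <- p].

Definition up_opp (p : up R) : up R := [seq mp_opp a | a <- p].

Definition up_mul (p q : up R) : up R :=
  foldr (fun a r => up_add (up_scale a q) ([::] :: r)) [::] p.

(** The fold carries p together with p', by (a + X p)' = p + X p'. *)
Definition up_deriv (p : up R) : up R :=
  (foldr (fun a s => (a :: s.1, up_add s.1 ([::] :: s.2))) ([::], [::]) p).2.

Definition lead (p : up R) : mp R := nth [::] p (size p).-1.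

Definition sign_test (p : mp R) : branching R R :=
  [:: ([:: (p, true)], 1); ([:: (p, false)], 0); ([:: (mp_opp p, true)], -1)].

(** The fold starts from the leading coefficient and stops testing at the first nonzero one.
    Nonvanishing takes two branches, since conditions only express p > 0 and p = 0. *)
Definition trim (p : up R) : branching R (up R) :=
  foldr (fun a m => bind m (fun r =>
    if r is _ :: _ then ret (a :: r)
    else [:: ([:: (a, true)], [:: a]); ([:: (a, false)], [::]);
             ([:: (mp_opp a, true)], [:: a])]))
  (ret [::]) p.

(* The dividend is multiplied by the square of the leading coefficient of q, so
   that the remainder is exact up to a positive factor. *)
Definition reduce (q r : up R) : branching R (up R) :=
  if (size r < size q)%N then ret r
  else trim (up_add (up_scale (mp_mul (lead q) (lead q)) r)
    (up_opp (iter (size r - size q) (cons [::])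
       (up_scale (mp_mul (lead q) (lead r)) q)))).

(** For q nonzero and trimmed, each effective round lowers the size, and [reduce] returns its
    argument once the size is below that of q. Hence [size p] rounds suffice. *)
Definition pseudo_rem (p q : up R) : branching R (up R) :=
  iter (size p) (fun m => bind m (reduce q)) (ret p).

(* With r the remainder of p by q, Ind(q/p) = e + Ind(-r/q), where e is the sign
   of the product of the leading coefficients if the degrees of p and q have
   different parities and 0 otherwise. The last component collects the e. *)
Definition index_step (s : up R * up R * R) : branching R (up R * up R * R) :=
  if size s.1.2 == 0%N then ret s
  else bind (sign_test (mp_mul (lead s.1.1) (lead s.1.2))) (fun e =>
    bind (pseudo_rem s.1.1 s.1.2) (fun r =>
      ret (s.1.2, up_opp r,
           s.2 + (if odd (size s.1.1 + size s.1.2) then e else 0)))).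

(** The Tarski query, the sum of the signs of q at the roots of p, is the Cauchy index of p' q / p.
    The second component of the state shrinks at each step, so [size d] steps suffice. *)
Definition tarski_query (p q : up R) : branching R R :=
  bind (trim (up_mul (up_deriv p) q)) (fun d =>
    bind (iter (size d) (fun m => bind m index_step) (ret (p, d, 0)))
         (fun s => ret s.2)).

Definition sum_queries (p : up R) (s : seq (up R)) : branching R R :=
  foldr (fun q m => bind (tarski_query p q) (fun t =>
    bind m (fun u => ret (t + u)))) (ret 0) s.

(* The products q_1^e_1 * ... * q_s^e_s with all e_i in {1, 2}. *)
Definition products (s : seq (up R)) : seq (up R) :=
  foldr (fun q l => [seq up_mul q p | p <- l] ++
                    [seq up_mul (up_mul q q) p | p <- l]) [:: [:: mp_one]] s.

Definition up_prod (s : seq (up R)) : up R := foldr up_mul [:: mp_one] s.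

Definition trim_all (s : seq (up R)) : branching R (seq (up R)) :=
  foldr (fun q m => bind (trim q) (fun q' => bind m (fun l => ret (q' :: l))))
    (ret [::]) s.

Definition all_pos (s : seq (mp R)) : branching R R :=
  foldr (fun p m => bind (sign_test p) (fun e => if 0 < e then m else ret 0))
    (ret 1) s.

Definition pos_pinfty (s : seq (up R)) : branching R R :=
  all_pos [seq lead q | q <- s].

(** An odd size means an even degree, and then the sign at minus infinity is that of the leading
    coefficient. *)
Definition pos_minfty (s : seq (up R)) : branching R R :=
  all_pos [seq if odd (size q) then lead q else mp_opp (lead q) | q <- s].

(* If p vanishes identically, the strict inequalities have a solution iff they
   hold near one of the infinities or at a root of the derivative of their
   product. *)
Definition count_solutions (p : up R) (s : seq (up R)) : branching R R :=
  bind (trim p) (fun p =>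
    if size p == 0%N then
      bind (trim_all s) (fun s => bind (pos_pinfty s) (fun a =>
        bind (pos_minfty s) (fun b => bind (trim (up_deriv (up_prod s))) (fun d =>
          bind (sum_queries d (products s)) (fun c => ret (a + b + c))))))
    else sum_queries p (products s)).

Definition univariate (v : var) (p : mp R) : up R :=
  foldr (fun t r => up_add
    (foldr (fun u q => if u == v then [::] :: q
                       else up_scale [:: (1, [:: u])] q)
           [:: [:: (t.1, [::])]] t.2) r)
  [::] p.

Definition sum_of_squares (c : conditions R) : mp R :=
  flatten [seq if t.2 then [::] else mp_mul t.1 t.1 | t <- c].

Definition positives (c : conditions R) : seq (mp R) :=
  flatten [seq if t.2 then [:: t.1] else [::] | t <- c].

(** On each branch the count is a number, not a polynomial, so its sign is known at once. The
    branches with a positive count cover exactly the parameters for which a value of [v] exists. *)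
Definition eliminate (v : var) (c : conditions R) : seq (conditions R) :=
  flatten [seq if 0 < b.2 then [:: b.1] else [::]
          | b <- count_solutions (univariate v (sum_of_squares c))
                   [seq univariate v q | q <- positives c]].

(** The value at the origin, where only empty words contribute. It is taken once the variables have
    been eliminated. *)
Definition mp_eval0 (p : mp R) : R :=
  foldr (fun t r => (if size t.2 == 0%N then t.1 else 0) + r) 0 p.

(** p = 0 is expressed as neither p > 0 nor - p > 0, positivity being the one sign test with a
    computability rule. *)
Definition holds0 (c : conditions R) : bool :=
  foldr (fun t b => if b then
      (if t.2 then 0 < mp_eval0 t.1
       else if 0 < mp_eval0 t.1 then false else ~~ (0 < - mp_eval0 t.1))
    else false) true c.

Definition satisfiable (vs : seq var) (d : seq (conditions R)) : bool :=
  foldr (fun c b => if holds0 c then true else b) false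
    (foldr (fun v d => flatten [seq eliminate v c | c <- d]) d vs).

Fixpoint eval_comb (n : nat) (b : bool_comb n) (a : var) : bool :=
  match b with
  | Atom i => nth false a i
  | Compl b1 => ~~ eval_comb b1 a
  | Union b1 b2 => eval_comb b1 a || eval_comb b2 a
  | Inter b1 b2 => eval_comb b1 a && eval_comb b2 a
  end.

Definition eval_comb_code (b : comb_code) (a : var) : bool :=
  eval_comb (projT2 b) a.

Definition sign_vectors (n : nat) : seq var :=
  iter n (fun s => [seq true :: a | a <- s] ++ [seq false :: a | a <- s]) [:: [::]].

Definition sum_vars (s : seq var) : mp R := [seq (1, [:: a]) | a <- s].

Definition comb_mp (vs : seq var) (b : comb_code) : mp R :=
  flatten [seq if eval_comb_code b a then [:: (1, [:: a])] else [::]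
          | a <- vs].

Definition substitute (xs : seq (mp R)) (g : seq (R * seq nat)) : mp R :=
  flatten [seq mp_mul [:: (t.1, [::])]
    (foldr (fun j r => iter (nth 0%N t.2 j) (mp_mul (nth [::] xs j)) r)
           mp_one (iota 0 (size t.2)))
  | t <- g].

(* The first component of r is 0 for =, 1 for <>, 2 for >=. *)
Definition relation_dnf (xs : seq (mp R)) (r : relation_code R) : seq (conditions R) :=
  let g := substitute xs r.2 in
  if r.1 == 0%N then [:: [:: (g, false)]]
  else if r.1 == 1%N then [:: [:: (g, true)]; [:: (mp_opp g, true)]]
  else [:: [:: (g, true)]; [:: (g, false)]].

Definition negation_dnf (xs : seq (mp R)) (r : relation_code R) : seq (conditions R) :=
  let g := substitute xs r.2 in
  if r.1 == 0%N then [:: [:: (g, true)]; [:: (mp_opp g, true)]]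
  else if r.1 == 1%N then [:: [:: (g, false)]]
  else [:: [:: (mp_opp g, true)]].

Definition dnf_and (d d' : seq (conditions R)) : seq (conditions R) :=
  flatten [seq [seq c ++ c' | c' <- d'] | c <- d].

Definition simplex_dnf (vs : seq var) : seq (conditions R) :=
  foldr (fun a d => dnf_and [:: [:: ([:: (1, [:: a])], true)];
                               [:: ([:: (1, [:: a])], false)]] d)
    [:: [:: ((- 1, [::]) :: sum_vars vs, false)]] vs.

Definition counterexample_dnf (vs : seq var) (xs : seq (mp R))
    (rs : seq (relation_code R)) (r : relation_code R) : seq (conditions R) :=
  dnf_and (negation_dnf xs r)
    (foldr (fun q d => dnf_and (relation_dnf xs q) d) (simplex_dnf vs) rs).

Definition no_counterexample (i : problem_code R) : R :=
  let vs := sign_vectors i.1 in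
  let xs := [seq comb_mp vs b | b <- i.2.2.1] in
  if satisfiable vs (counterexample_dnf vs xs i.2.2.2.1 i.2.2.2.2.1)
  then 0 else 1.

End Procedure.

(** * Programs for the elimination procedure *)

Section ComputableProcedure.
Variable R : realType.

#[local] Instance computable_ret (A : Type) {EA : encodable R A} :
  computable1 (@ret R A).
Proof. computable_tac. Qed.

Lemma computable_bind X env (A B : Type) {EA : encodable R A}
    {EB : encodable R B} (m : X -> branching R A) (F : X -> A -> branching R B) :
  computable env m ->
  computable (fun y : X * (conditions R * A) * seq (branching R B) =>
    [:: None, None, Some (enc y.1.2), None, None, None & env y.1.1])
    (fun y => F y.1.1 y.1.2.2) ->
  computable env (fun x => bind (m x) (F x)).
Proof.
move=> Hm HF; refine (computable_app1 (f := @flatten _) _).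
refine (computable_map Hm _); refine (computable_map HF _); computable_tac.
Qed.

Ltac computable_binder ::=
  lazymatch goal with
  | |- computable _ (fun x => map _ _) => refine (computable_map _ _)
  | |- computable _ (fun x => iter _ _ _) => refine (computable_iter _ _ _)
  | |- computable _ (fun x => bind _ _) => refine (computable_bind _ _)
  | |- computable _ (fun x => mp_one _) => unfold mp_one
  end.

#[local] Instance computable_mp_opp : computable1 (@mp_opp R).
Proof. computable_tac. Qed.

#[local] Instance computable_mp_mul : computable2 (@mp_mul R).
Proof. computable_tac. Qed.

#[local] Instance computable_up_add : computable2 (@up_add R).
Proof. computable_tac. Qed.

#[local] Instance computable_up_scale : computable2 (@up_scale R).
Proof. computable_tac. Qed.

#[local] Instance computable_up_opp : computable1 (@up_opp R).
Proof. computable_tac. Qed.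

#[local] Instance computable_up_mul : computable2 (@up_mul R).
Proof. computable_tac. Qed.

#[local] Instance computable_up_deriv : computable1 (@up_deriv R).
Proof. computable_tac. Qed.

#[local] Instance computable_lead : computable1 (@lead R).
Proof. computable_tac. Qed.

#[local] Instance computable_sign_test : computable1 (@sign_test R).
Proof. computable_tac. Qed.

#[local] Instance computable_trim : computable1 (@trim R).
Proof. computable_tac. Qed.

#[local] Instance computable_reduce : computable2 (@reduce R).
Proof. computable_tac. Qed.

#[local] Instance computable_pseudo_rem : computable2 (@pseudo_rem R).
Proof. computable_tac. Qed.

#[local] Instance computable_index_step : computable1 (@index_step R).
Proof. computable_tac. Qed.

#[local] Instance computable_tarski_query : computable2 (@tarski_query R).
Proof. computable_tac. Qed.

#[local] Instance computable_sum_queries : computable2 (@sum_queries R).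
Proof. computable_tac. Qed.

#[local] Instance computable_products : computable1 (@products R).
Proof. computable_tac. Qed.

#[local] Instance computable_up_prod : computable1 (@up_prod R).
Proof. computable_tac. Qed.

#[local] Instance computable_trim_all : computable1 (@trim_all R).
Proof. computable_tac. Qed.

#[local] Instance computable_all_pos : computable1 (@all_pos R).
Proof. computable_tac. Qed.

#[local] Instance computable_pos_pinfty : computable1 (@pos_pinfty R).
Proof. computable_tac. Qed.

#[local] Instance computable_pos_minfty : computable1 (@pos_minfty R).
Proof. computable_tac. Qed.

#[local] Instance computable_count_solutions : computable2 (@count_solutions R).
Proof. computable_tac. Qed.

#[local] Instance computable_univariate : computable2 (@univariate R).
Proof. computable_tac. Qed.

#[local] Instance computable_sum_of_squares : computable1 (@sum_of_squares R).
Proof. computable_tac. Qed.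

#[local] Instance computable_positives : computable1 (@positives R).
Proof. computable_tac. Qed.

#[local] Instance computable_eliminate : computable2 (@eliminate R).
Proof. computable_tac. Qed.

#[local] Instance computable_mp_eval0 : computable1 (@mp_eval0 R).
Proof. computable_tac. Qed.

#[local] Instance computable_holds0 : computable1 (@holds0 R).
Proof. computable_tac. Qed.

#[local] Instance computable_satisfiable : computable2 (@satisfiable R).
Proof. computable_tac. Qed.

#[global] Instance encodable_comb : encodable R comb_code :=
  fun b => enc_bool_comb R (projT2 b).

(** [eval_comb] recurses on a tree, which the rules for lists do not cover, so its program is
    written by hand. The sign vector stays available through the original input, which lies below
    the closure in every recursive call. *)
#[local] Instance computable_eval_comb_code :
  computable2 (R := R) eval_comb_code.
Proof.
(* The case of an atom: [Atom i] has the code of the pair (0, i), and below the closure lies the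
   input with the sign vector. *)
have [ea Ha] : computable
    (fun x : (nat * nat) * (comb_code * var) =>
      [:: Some (enc x.1); None; Some (enc x.2)])
    (fun x => nth false x.2.2 x.1.2) by computable_tac.
pose eb (c : bool) := enc_nat R c.
pose call e := EApp (EVar 1) e.
pose l := call (EFst (ESnd (EVar 0))); pose r := call (ESnd (ESnd (EVar 0))).
pose tt := EPair ENil ENil.
pose tag := EFst (EVar 0).
(* The tags 0, 1, 2, 3 are told apart by taking successive tails. The last two conditionals are the
   short-circuit forms of disjunction and conjunction. *)
pose body := EIfNil tag ea
  (EIfNil (ESnd tag) (EIfNil (call (ESnd (EVar 0))) tt ENil)
    (EIfNil (ESnd (ESnd tag)) (EIfNil l r tt) (EIfNil l ENil r))).
exists (EApp (EFun body) (EFst (EVar 0))) => -[[n b] a] [//|w rho] /= [<- {w} _].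
pose w (b0 : comb_code) := VPair (enc_bool_comb R (projT2 b0))
  (enc_seq [seq enc_nat R (nat_of_bool c) | c <- a]).
pose self b0 := VClosure (w b0 :: rho) body.
have runT (env : seq (value R)) : run env tt (eb true).
  by apply: run_Pair; apply: run_Nil.
have runF (env : seq (value R)) : run env ENil (eb false) by apply: run_Nil.
have runV b0 v : run [:: v, self b0, w b0 & rho] (EVar 0) v by apply: run_Var.
have run_tag b0 v1 v2 : run [:: VPair v1 v2, self b0, w b0 & rho] tag v1.
  exact: run_Fst (runV _ _).
have run_arg b0 v1 v2 :
    run [:: VPair v1 v2, self b0, w b0 & rho] (ESnd (EVar 0)) v2.
  exact: run_Snd (runV _ _).
have run_call b0 v e v' (c : bool) :
    run [:: v, self b0, w b0 & rho] e v' ->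
    run [:: v', self b0, w b0 & rho] body (eb c) ->
    run [:: v, self b0, w b0 & rho] (call e) (eb c).
  by move=> h1 h2; apply: run_App h1 h2; exact: run_Var.
have runIf env e e1 e2 (c c1 c2 : bool) : run env e (eb c) ->
    run env e1 (eb c1) -> run env e2 (eb c2) ->
    run env (EIfNil e e1 e2) (eb (if c then c2 else c1)).
  by case: c => h ? ?; [apply: run_IfNil_pair h _ | apply: run_IfNil_nil h _].
suff key : forall m (c : bool_comb m) b0,
    run [:: enc_bool_comb R c, self b0, w b0 & rho] body (eb (eval_comb c a)).
  apply: run_App; [exact: run_Fun | by apply: run_Fst; exact: run_Var |].
  exact: (key n b (existT _ n b)).
move=> m c b0; elim: c => /= [i|b1 IH|b1 IH1 b2 IH2|b1 IH1 b2 IH2].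
- apply: run_IfNil_nil; first exact: run_tag.
  by apply: (Ha ((0%N, nat_of_ord i), (b0, a))); split=> //; split.
- apply: run_IfNil_pair; first exact: run_tag.
  apply: run_IfNil_nil; first exact: run_Snd (run_tag _ _ _).
  have -> : ~~ eval_comb b1 a = if eval_comb b1 a then false else true by [].
  by apply: runIf => //; apply: run_call IH.
- apply: run_IfNil_pair; first exact: run_tag.
  apply: run_IfNil_pair; first exact: run_Snd (run_tag _ _ _).
  apply: run_IfNil_nil; first exact: run_Snd (run_Snd (run_tag _ _ _)).
  apply: runIf => //; first by apply: run_call IH1; apply: run_Fst (run_arg _ _ _).
  by apply: run_call IH2; apply: run_Snd (run_arg _ _ _).
- apply: run_IfNil_pair; first exact: run_tag.
  apply: run_IfNil_pair; first exact: run_Snd (run_tag _ _ _).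
  apply: run_IfNil_pair; first exact: run_Snd (run_Snd (run_tag _ _ _)).
  apply: runIf => //; first by apply: run_call IH1; apply: run_Fst (run_arg _ _ _).
  by apply: run_call IH2; apply: run_Snd (run_arg _ _ _).
Qed.

#[local] Instance computable_sign_vectors : computable1 (R := R) sign_vectors.
Proof. computable_tac. Qed.

#[local] Instance computable_sum_vars : computable1 (@sum_vars R).
Proof. computable_tac. Qed.

#[local] Instance computable_comb_mp : computable2 (@comb_mp R).
Proof. computable_tac. Qed.

#[local] Instance computable_substitute : computable2 (@substitute R).
Proof. computable_tac. Qed.

#[local] Instance computable_relation_dnf : computable2 (@relation_dnf R).
Proof. computable_tac. Qed.

#[local] Instance computable_negation_dnf : computable2 (@negation_dnf R).
Proof. computable_tac. Qed.

#[local] Instance computable_dnf_and : computable2 (@dnf_and R).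
Proof. computable_tac. Qed.

#[local] Instance computable_simplex_dnf : computable1 (@simplex_dnf R).
Proof. computable_tac. Qed.

#[local] Instance computable_counterexample_dnf : computable4 (@counterexample_dnf R).
Proof. computable_tac. Qed.

#[local] Instance computable_no_counterexample : computable1 (@no_counterexample R).
Proof. computable_tac. Qed.

End ComputableProcedure.

(** * Correctness of the elimination *)

Section CauchyIndex.
Variable R : realType.
Implicit Types p q r s : {poly R}.

(** [jump_mod] is about pseudo-remainders and carries a sign; dividing by the power of the leading
    coefficient, as [%%] does, absorbs it. *)
Lemma jump_modp p q x : jump p q x = jump (p %% q) q x.
Proof.
have [->|q0] := eqVneq q 0; first by rewrite modp0.
rewrite modpE jump_mod jump_mulCp; congr (_ * _).
by rewrite -sgzX /sgz invr_eq0 invr_lt0.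
Qed.

(** c p / q and r / q differ by the polynomial s, which has no jumps, and c > 0 keeps the signs of
    the jumps. *)
Lemma cindexR_congr p q r s (c : R) :
  0 < c -> c *: p = s * q + r -> cindexR p q = cindexR r q.
Proof.
move=> c_gt0 E; rewrite /cindexR; apply: eq_bigr => x _.
rewrite [RHS]jump_modp -[r %% q]add0r -(modp_mull s q) -modpD -E -jump_modp.
by rewrite jump_mulCp gtr0_sgz // mul1r.
Qed.

Lemma cindexR_opp p q : cindexR (- p) q = - cindexR p q.
Proof.
rewrite /cindexR -sumrN; apply: eq_bigr => x _.
by rewrite -scaleN1r jump_mulCp sgzN sgz1 mulN1r.
Qed.

(** The sign of p q changes between the two infinities iff its degree is odd, and it ends as the
    sign of the leading coefficient. Passing from degrees to sizes adds 2 and keeps the parity. *)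
Lemma crossR_lead p q : p != 0 -> q != 0 ->
  crossR (p * q) =
    if odd (size p + size q) then sgz (lead_coef p * lead_coef q) else 0.
Proof.
move=> p0 q0; have l0 : lead_coef p * lead_coef q != 0.
  by rewrite mulf_neq0 ?lead_coef_eq0.
have par : odd (size (p * q)).-1 = odd (size p + size q).
  rewrite size_mul // (polySpred p0) (polySpred q0) addSn addnS /=.
  by rewrite !negbK.
rewrite /crossR /variation /sgp_minfty /sgp_pinfty lead_coefM -signr_odd par.
rewrite sgz_sgr -sgrM sgr_lt0; case: odd.
  rewrite expr1 mulN1r mulNr oppr_lt0 -expr2 exprn_even_gt0 //.
  by rewrite l0 mulr1.
by rewrite expr0 mul1r -expr2 ltNge sqr_ge0 mulr0.
Qed.

(** The justification of [index_step]: in the inversion formula [cindexR_rec] any signed remainder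
    will do, as long as the multiplier c is positive. *)
Lemma cindexR_step p q r s (c : R) : p != 0 -> q != 0 ->
  0 < c -> c *: p = s * q + r ->
  cindexR q p =
    (if odd (size p + size q) then sgz (lead_coef p * lead_coef q) else 0)
    + cindexR (- r) q.
Proof.
move=> p0 q0 c_gt0 E; rewrite cindexR_rec crossR_lead //; congr (_ + _).
(* Both remainders give minus the index of p / q. *)
rewrite cindexR_opp -(cindexR_congr c_gt0 E).
rewrite /cindexR -sumrN; apply: eq_bigr => x _.
by rewrite [in RHS]jump_mod /next_mod jump_mulCp sgzN sgzX mulNr.
Qed.

End CauchyIndex.

(** * Evaluation of symbolic polynomials and specification of branching computations *)

Section Correctness.
Variable R : realType.

Definition mp_eval (y : var -> R) (p : mp R) : R :=
  \sum_(t <- p) t.1 * \prod_(v <- t.2) y v.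

Definition up_eval (y : var -> R) (p : up R) : {poly R} := Poly (map (mp_eval y) p).

Definition valid (y : var -> R) (c : conditions R) : bool :=
  all (fun t => if t.2 then 0 < mp_eval y t.1 else mp_eval y t.1 == 0) c.

(** Specification of a branching computation at the point y. The first conjunct excludes that the
    second holds for want of a branch taken at y. *)
Definition outcome (A : eqType) (y : var -> R) (m : branching R A) (P : A -> Prop) :=
  has (fun b => valid y b.1) m /\
  forall b, b \in m -> valid y b.1 -> P b.2.

Section Evaluation.
Variable y : var -> R.
Local Notation ev := (mp_eval y).
Local Notation eu := (up_eval y).

Lemma mp_eval_nil : ev [::] = 0.
Proof. by rewrite /mp_eval big_nil. Qed.

Lemma mp_eval_cons t p : ev (t :: p) = t.1 * \prod_(v <- t.2) y v + ev p.
Proof. by rewrite /mp_eval big_cons. Qed.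

Lemma mp_eval_cat p q : ev (p ++ q) = ev p + ev q.
Proof. by rewrite /mp_eval big_cat. Qed.

Lemma mp_eval_flatten s : ev (flatten s) = \sum_(p <- s) ev p.
Proof.
by elim: s => [|p s IH]; rewrite ?big_nil ?mp_eval_nil // big_cons mp_eval_cat IH.
Qed.

Lemma mp_eval_opp p : ev (mp_opp p) = - ev p.
Proof.
by rewrite /mp_eval big_map -sumrN; apply: eq_bigr => t _; rewrite mulNr.
Qed.

Lemma mp_eval_mul p q : ev (mp_mul p q) = ev p * ev q.
Proof.
rewrite /mp_mul mp_eval_flatten big_map {2}/mp_eval mulr_suml.
apply: eq_bigr => s _; rewrite /mp_eval big_map mulr_sumr.
by apply: eq_bigr => t _; rewrite big_cat mulrACA.
Qed.

Lemma mp_eval_one : ev (mp_one R) = 1.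
Proof. by rewrite mp_eval_cons big_nil mp_eval_nil addr0 mulr1. Qed.

Lemma coef_up_eval p i : (eu p)`_i = ev (nth [::] p i).
Proof.
rewrite coef_Poly; have [lt_ip|le_pi] := ltnP i (size p).
  by rewrite (nth_map [::]).
by rewrite !nth_default ?size_map // mp_eval_nil.
Qed.

Lemma up_eval_nil : eu [::] = 0.
Proof. by []. Qed.

Lemma up_eval_cons a p : eu (a :: p) = (ev a)%:P + eu p * 'X.
Proof. by rewrite /up_eval /= cons_poly_def addrC. Qed.

Lemma up_eval_add p q : eu (up_add p q) = eu p + eu q.
Proof.
apply/polyP => i; rewrite coefD !coef_up_eval -mp_eval_cat.
have [lt_i|le_i] := ltnP i (size p + size q).
  by rewrite (nth_map 0%N) ?size_iota // nth_iota.
rewrite !nth_default ?size_map ?size_iota //.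
  exact: leq_trans (leq_addl _ _) le_i.
exact: leq_trans (leq_addr _ _) le_i.
Qed.

Lemma up_eval_scale c p : eu (up_scale c p) = ev c *: eu p.
Proof.
elim: p => [|a p IH]; rewrite /= ?up_eval_nil ?scaler0 // !up_eval_cons IH.
by rewrite mp_eval_mul polyCM scalerDr scalerAl mul_polyC.
Qed.

Lemma up_eval_opp p : eu (up_opp p) = - eu p.
Proof.
elim: p => [|a p IH]; rewrite /= ?up_eval_nil ?oppr0 // !up_eval_cons IH.
by rewrite mp_eval_opp polyCN opprD mulNr.
Qed.

Lemma up_eval_shift p : eu ([::] :: p) = eu p * 'X.
Proof. by rewrite up_eval_cons mp_eval_nil add0r. Qed.

Lemma up_eval_iter_shift n p : eu (iter n (cons [::]) p) = eu p * 'X^n.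
Proof.
by elim: n => [|n IH]; rewrite ?mulr1 //= up_eval_shift IH exprSr mulrA.
Qed.

Lemma up_eval_mul p q : eu (up_mul p q) = eu p * eu q.
Proof.
elim: p => [|a p IH]; first by rewrite up_eval_nil mul0r.
rewrite /= up_eval_add up_eval_scale up_eval_shift IH up_eval_cons mulrDl.
by rewrite mul_polyC mulrAC.
Qed.

Lemma up_eval_deriv p : eu (up_deriv p) = (eu p)^`().
Proof.
rewrite /up_deriv; set F := fun a s => _.
suff [] : (foldr F ([::], [::]) p).1 = p /\
    eu (foldr F ([::], [::]) p).2 = (eu p)^`() by [].
elim: p => [|a p [IH1 IH2]] /=; first by rewrite up_eval_nil deriv0.
rewrite IH1 up_eval_add up_eval_shift IH2 up_eval_cons derivD derivC derivM derivX.
by rewrite add0r mulr1 addrC.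
Qed.

Lemma up_eval_one : eu [:: mp_one R] = 1.
Proof. by rewrite up_eval_cons up_eval_nil mul0r addr0 mp_eval_one. Qed.

Lemma up_eval_prod s : eu (up_prod s) = \prod_(q <- s) eu q.
Proof.
elim: s => [|q s IH]; first by rewrite big_nil up_eval_one.
by rewrite big_cons -IH /= up_eval_mul.
Qed.

(** No leading zeros at y: sizes of lists are then sizes of polynomials. *)
Definition trimmed (p : up R) : bool := size (eu p) == size p.

Lemma trimmed_eq0 p : trimmed p -> (eu p == 0) = (size p == 0)%N.
Proof. by move/eqP <-; rewrite size_poly_eq0. Qed.

Lemma mp_eval_lead p : trimmed p -> ev (lead p) = lead_coef (eu p).
Proof. by move/eqP=> E; rewrite /lead_coef E coef_up_eval. Qed.

Lemma trimmed_opp p : trimmed p -> trimmed (up_opp p).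
Proof. by rewrite /trimmed up_eval_opp size_polyN size_map. Qed.

Section Outcomes.
Variables A B : eqType.

Lemma outcome_ret (a : A) (P : A -> Prop) : P a -> outcome y (ret R a) P.
Proof. by move=> Pa; split=> // b; rewrite inE => /eqP ->. Qed.

Lemma outcome_imp (m : branching R A) (P Q : A -> Prop) :
  (forall a, P a -> Q a) -> outcome y m P -> outcome y m Q.
Proof. by move=> PQ [h H]; split=> // b bm /(H b bm)/PQ. Qed.

Lemma outcome_bind (m : branching R A) (F : A -> branching R B)
    (P : A -> Prop) (Q : B -> Prop) :
  outcome y m P -> (forall a, P a -> outcome y (F a) Q) ->
  outcome y (bind m F) Q.
Proof.
move=> [/hasP[b bm vb] H] HF; split.
  have [/hasP[c cF vc] _] := HF _ (H b bm vb).
  apply/hasP; exists (b.1 ++ c.1, c.2); last by rewrite /valid all_cat; apply/andP.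
  apply/flattenP; exists [seq (b.1 ++ c.1, c.2) | c <- F b.2].
    by apply/mapP; exists b.
  by apply/mapP; exists c.
move=> d /flattenP[_ /mapP[{vb}b {}bm ->] /mapP[c cF ->]] /=.
rewrite /valid all_cat => /andP[vb vc].
by have [_] := HF _ (H b bm vb); apply.
Qed.

End Outcomes.

(** The rule for loops, with [P i] as the invariant after i rounds. *)
Lemma outcome_iter (A : eqType) (F : A -> branching R A) (P : nat -> A -> Prop) n a :
  (forall i a, P i a -> outcome y (F a) (P i.+1)) -> P 0%N a ->
  outcome y (iter n (fun m => bind m F) (ret R a)) (P n).
Proof.
move=> HF P0; elim: n => [|n IH] /=; first exact: outcome_ret.
by apply: outcome_bind IH _ => b; apply: HF.
Qed.

Lemma outcome_sign_test p :
  outcome y (sign_test p) (fun s => s = Num.sg (ev p)).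
Proof.
rewrite /outcome /sign_test /= !andbT !mp_eval_opp oppr_gt0; split.
  by case: ltrgtP.
by move=> b; rewrite !inE => /or3P[] /eqP -> /=; rewrite /valid /= andbT
  ?mp_eval_opp ?oppr_gt0 => h; rewrite ?(gtr0_sg h) ?(ltr0_sg h) ?(eqP h) ?sgr0.
Qed.

Lemma outcome_trim p :
  outcome y (trim p) (fun q => trimmed q /\ eu q = eu p).
Proof.
elim: p => [|a p IH].
  by apply: outcome_ret; rewrite /trimmed up_eval_nil size_poly0.
apply: outcome_bind IH _ => -[|b r] [tr E]; last first.
  apply: outcome_ret; rewrite /trimmed !(up_eval_cons a) -E; split=> //.
  by move/eqP: tr; rewrite addrC size_MXaddC -size_poly_eq0 => ->.
have E' : eu (a :: p) = (ev a)%:P.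
  by rewrite up_eval_cons -E up_eval_nil mul0r addr0.
have Ea : eu [:: a] = (ev a)%:P by rewrite up_eval_cons up_eval_nil mul0r addr0.
rewrite /outcome /= !andbT !mp_eval_opp oppr_gt0; split; first by case: ltrgtP.
move=> c; rewrite !inE => /or3P[] /eqP -> /=; rewrite /valid /= andbT E' => h.
- by rewrite /trimmed Ea size_polyC (gt_eqF h).
- by rewrite /trimmed up_eval_nil (eqP h) polyC0 size_poly0.
- move: h; rewrite mp_eval_opp oppr_gt0 => h.
  by rewrite /trimmed Ea size_polyC (lt_eqF h).
Qed.

End Evaluation.

(** * Remainders, Tarski queries and the count of solutions *)

Section Evaluation.
Variable y : var -> R.
Local Notation ev := (mp_eval y).
Local Notation eu := (up_eval y).

Lemma outcome_reduce q r :
  trimmed y q -> (0 < size q)%N -> trimmed y r ->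
  outcome y (reduce q r) (fun r' =>
    [/\ trimmed y r',
        exists2 c, 0 < c & exists s, c *: eu r = s * eu q + eu r' &
        (size r' < size q)%N || (size r' < size r)%N]).
Proof.
move=> tq q_gt0 tr; rewrite /reduce; case: ifP => lt_rq.
  apply: outcome_ret; rewrite lt_rq; split=> //.
  by exists 1 => //; exists 0; rewrite mul0r add0r scale1r.
apply: outcome_imp (outcome_trim y _) => r' [tr' E].
set k := (size r - size q)%N in E.
have q0 : eu q != 0 by rewrite trimmed_eq0 // -lt0n.
have r0 : eu r != 0.
  by rewrite trimmed_eq0 // -lt0n (leq_trans q_gt0) // leqNgt lt_rq.
set a := lead_coef (eu q); set b := lead_coef (eu r).
have a0 : a != 0 by rewrite lead_coef_eq0.
have b0 : b != 0 by rewrite lead_coef_eq0.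
have E' : eu r' = (a * a) *: eu r - (a * b) *: (eu q * 'X^k).
  rewrite E up_eval_add up_eval_scale up_eval_opp up_eval_iter_shift.
  by rewrite up_eval_scale !mp_eval_mul !mp_eval_lead // -/a -/b scalerAl.
split=> //.
  exists (a * a); first by rewrite lt_neqAle eq_sym mulf_neq0 // -expr2 sqr_ge0.
  by exists ((a * b) *: 'X^k); rewrite E' -scalerAl ['X^k * _]mulrC addrC subrK.
apply/orP; right; rewrite -(eqP tr') -(eqP tr).
have -> : size (eu r) = (size (eu r)).-1.+1 by apply: polySpred.
(* The size drops because the coefficients of degree deg r cancel, and above that degree both terms
   vanish. *)
rewrite ltnS; apply/leq_sizeP => j; rewrite leq_eqVlt => /orP[/eqP <-|lt_j].
  rewrite E' coefB !coefZ coefMXn -/(lead_coef (eu r)) -/b.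
  have -> : ((size (eu r)).-1 < k)%N = false.
    rewrite (eqP tr) /k; apply/negbTE; rewrite -leqNgt.
    by rewrite -subn1 leq_sub2l.
  have -> : ((size (eu r)).-1 - k = (size (eu q)).-1)%N.
    rewrite (eqP tr) (eqP tq) /k -subn1 subnAC subKn ?subn1 //.
    by rewrite leqNgt lt_rq.
  by rewrite -/(lead_coef (eu q)) -/a mulrAC subrr.
rewrite E' coefB !coefZ coefMXn [(eu r)`_j]nth_default; last first.
  by rewrite (polySpred r0).
case: ifP => [_|/negbT]; rewrite ?mulr0 ?subrr // -leqNgt => le_kj.
rewrite [(eu q)`_ _]nth_default ?mulr0 ?subrr //.
rewrite (eqP tq) leq_subRL //.
move: lt_j; rewrite -[(_ < j)%N]/(_.+1 <= j)%N -polySpred // (eqP tr).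
by rewrite /k subnK // leqNgt lt_rq.
Qed.

Lemma outcome_pseudo_rem p q :
  trimmed y q -> (0 < size q)%N -> trimmed y p ->
  outcome y (pseudo_rem p q) (fun r =>
    [/\ trimmed y r, (size r < size q)%N &
        exists2 c, 0 < c & exists s, c *: eu p = s * eu q + eu r]).
Proof.
move=> tq q_gt0 tp.
(* Invariant after n rounds: modulo q, r is a positive multiple of p, and either the division is
   finished or the size has dropped by at least n. *)
pose P n r := [/\ trimmed y r,
  exists2 c, 0 < c & exists s, c *: eu p = s * eu q + eu r &
  (size r < size q)%N || (size r + n <= size p)%N].
have := @outcome_iter y _ (reduce q) P (size p) p.
case=> [i r [tr [c c_gt0 [s E]] lt_r]||h H].
- apply: outcome_imp (outcome_reduce tq q_gt0 tr) => r' [tr' [d d_gt0 [t E']] lt].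
  split=> //.
    exists (d * c); first exact: mulr_gt0.
    exists (d *: s + t); rewrite -scalerA E scalerDr E' mulrDl scalerAl.
    by rewrite addrA.
  case/orP: lt => [->//|lt]; case/orP: lt_r => [lt_rq|le_rp].
    by rewrite (ltn_trans lt lt_rq).
  by rewrite addnS (leq_trans _ le_rp) ?orbT // ltn_add2r.
- split=> //; last by rewrite addn0 leqnn orbT.
  by exists 1 => //; exists 0; rewrite mul0r add0r scale1r.
apply: outcome_imp (conj h H) => r [tr E /orP lt]; split=> //.
(* After [size p] rounds an unfinished division would leave size 0, which is below the size of q
   anyway. *)
case: lt => //; rewrite -{2}[size p]add0n leq_add2r leqn0 => /eqP ->.
exact: q_gt0.
Qed.

Lemma outcome_tarski_query p q : trimmed y p ->
  outcome y (tarski_query p q) (fun t => t = (taq (rootsR (eu p)) (eu q))%:~R).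
Proof.
move=> tp; apply: outcome_bind (outcome_trim y _) _ => d [td Ed].
(* For p = 0 also p' q = 0, no step is made, and the query is 0 because [rootsR 0] is empty. *)
have [p_0|p_gt0] := posnP (size p).
  move: Ed td; rewrite (size0nil p_0) up_eval_mul up_eval_deriv up_eval_nil.
  rewrite linear0 mul0r /trimmed => ->; rewrite size_poly0 eq_sym => /eqP ->.
  apply: (@outcome_bind _ _ _ _ _ (fun s => s.2 = 0)) => [|s ->];
    by apply: outcome_ret; rewrite // rootsR0 /taq big_nil.
(* Invariant: the accumulated value plus the Cauchy index of the current pair is the index of d / p,
   and the second component loses at least one in size per round until it is empty. *)
pose P n (s : up R * up R * R) := [/\ trimmed y s.1.1, (0 < size s.1.1)%N,
  trimmed y s.1.2, (size s.1.2 <= size d - n)%N &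
  s.2 + (cindexR (eu s.1.2) (eu s.1.1))%:~R = (cindexR (eu d) (eu p))%:~R].
apply: (@outcome_bind _ _ _ _ _ (P (size d))).
  apply: outcome_iter => [i [[p1 q1] acc]|]; last first.
    by split=> //=; rewrite ?subn0 ?add0r.
  case=> /= tp1 p1_gt0 tq1 le_q1 E; rewrite /index_step /=.
  case: ifP => [/eqP q1_0|/negbT].
    by apply: outcome_ret; split=> //=; rewrite q1_0.
  rewrite -lt0n => q1_gt0.
  apply: outcome_bind (outcome_sign_test y _) _ => e ->.
  apply: outcome_bind (outcome_pseudo_rem tq1 q1_gt0 tp1) _.
  move=> r [tr lt_r [c c_gt0 [s Er]]].
  apply: outcome_ret; split=> //=; first exact: trimmed_opp.
    by rewrite size_map -ltnS (leq_trans lt_r) // (leq_trans le_q1) // subnS leqSpred.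
  rewrite -E -addrA; congr (_ + _); rewrite up_eval_opp.
  rewrite (cindexR_step _ _ c_gt0 Er) ?trimmed_eq0 // -?lt0n // intrD.
  rewrite (eqP tp1) (eqP tq1) mp_eval_mul !mp_eval_lead // sgrEz.
  by case: odd.
(* The second component is now empty, so the accumulator is the whole index. *)
move=> [[p1 q1] acc] [/= tp1 _ tq1]; rewrite subnn leqn0 => /eqP q1_0.
rewrite (size0nil q1_0) up_eval_nil cindexR0p addr0 => ->.
apply: outcome_ret; rewrite taq_taqR /taqR changes_mods_cindex Ed.
by rewrite up_eval_mul up_eval_deriv.
Qed.

Lemma outcome_sum_queries p s : trimmed y p ->
  outcome y (sum_queries p s) (fun t =>
    t = \sum_(q <- s) (taq (rootsR (eu p)) (eu q))%:~R).
Proof.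
move=> tp; elim: s => [|q s IH]; first by apply: outcome_ret; rewrite big_nil.
apply: outcome_bind (outcome_tarski_query q tp) _ => t ->.
apply: outcome_bind IH _ => u ->.
by apply: outcome_ret; rewrite big_cons.
Qed.

(** Expanding the product of the factors sgn(q) + sgn(q)^2 chooses an exponent 1 or 2 for each q. *)
Lemma sum_products_sgr s x :
  \sum_(q <- products s) Num.sg (eu q).[x] =
  \prod_(q <- s) (Num.sg (eu q).[x] + Num.sg (eu q).[x] ^+ 2).
Proof.
elim: s => [|q s IH].
  by rewrite big_nil big_cons big_nil up_eval_one hornerC sgr1 addr0.
rewrite big_cons -IH /= big_cat !big_map /= mulrDl !mulr_sumr.
by congr (_ + _); apply: eq_bigr => p _; rewrite !up_eval_mul !hornerM !sgrM ?expr2.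
Qed.

Lemma sum_taq_products p s :
  \sum_(q <- products s) (taq (rootsR (eu p)) (eu q))%:~R =
  \sum_(x <- rootsR (eu p))
    \prod_(q <- s) (Num.sg (eu q).[x] + Num.sg (eu q).[x] ^+ 2) :> R.
Proof.
under [RHS]eq_bigr do rewrite -sum_products_sgr.
rewrite exchange_big /=; apply: eq_bigr => q _.
by rewrite /taq rmorph_sum /=; apply: eq_bigr => x _; rewrite sgrEz.
Qed.

Lemma prod_sgr_gt0 (s : seq (up R)) x :
  let z := \prod_(q <- s) (Num.sg (eu q).[x] + Num.sg (eu q).[x] ^+ 2) in
  0 <= z /\ (0 < z) = all (fun q => 0 < (eu q).[x]) s.
Proof.
rewrite /=; elim: s => [|q s [IH1 IH2]]; first by rewrite big_nil ltr01 ler01.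
rewrite big_cons /= -IH2; case: sgrP => _.
- by rewrite expr2 mulr0 addr0 mul0r ltxx.
- by rewrite expr1n mulr_ge0 ?addr_ge0 // pmulr_rgt0 ?addr_gt0.
- by rewrite sqrrN expr1n addNr mul0r ltxx.
Qed.

Lemma sum_products_gt0 p s : trimmed y p -> (0 < size p)%N ->
  let z : R := \sum_(q <- products s) (taq (rootsR (eu p)) (eu q))%:~R in
  0 <= z /\ (0 < z <->
    exists2 x, root (eu p) x & all (fun q => 0 < (eu q).[x]) s).
Proof.
move=> tp p_gt0 /=; rewrite sum_taq_products.
have p0 : eu p != 0 by rewrite trimmed_eq0 // -lt0n.
have ge0 x := (prod_sgr_gt0 s x).1.
split; first by apply: sumr_ge0 => x _.
split=> [|[x px sx]].
  rewrite lt0r => /andP[+ _]; rewrite psumr_neq0 // => /hasP[x xp].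
  rewrite /= (prod_sgr_gt0 s x).2 => sx; exists x => //.
  by rewrite -(roots_on_rootsR p0) in xp; case/andP: xp.
rewrite lt0r psumr_neq0 // sumr_ge0 // andbT; apply/hasP; exists x.
  by rewrite -(roots_on_rootsR p0) inE.
by rewrite /= (prod_sgr_gt0 s x).2.
Qed.

Lemma outcome_trim_all s :
  outcome y (trim_all s) (fun t => all (trimmed y) t /\ map eu t = map eu s).
Proof.
elim: s => [|q s IH]; first exact: outcome_ret.
apply: outcome_bind (outcome_trim y q) _ => q' [tq Eq].
apply: outcome_bind IH _ => t [tt Et]; apply: outcome_ret.
by rewrite /= tq tt Eq Et.
Qed.

Lemma outcome_all_pos s :
  outcome y (all_pos s) (fun e => e = (all (fun p => 0 < ev p) s)%:R).
Proof.
elim: s => [|p s IH]; first exact: outcome_ret.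
apply: outcome_bind (outcome_sign_test y p) _ => e ->; rewrite sgr_gt0 /=.
by case: ifP => _ //; apply: outcome_ret.
Qed.

Lemma outcome_pos_pinfty s : all (trimmed y) s ->
  outcome y (pos_pinfty s) (fun e =>
    e = (all (fun q => 0 < lead_coef (eu q)) s)%:R).
Proof.
move=> /allP ts; apply: outcome_imp (outcome_all_pos _) => e ->.
rewrite all_map; congr (nat_of_bool _)%:R; apply: eq_in_all => q /ts tq /=.
by rewrite mp_eval_lead.
Qed.

Lemma outcome_pos_minfty s : all (trimmed y) s ->
  outcome y (pos_minfty s) (fun e =>
    e = (all (fun q => 0 < (-1) ^+ (size (eu q)).-1 * lead_coef (eu q)) s)%:R).
Proof.
move=> /allP ts; apply: outcome_imp (outcome_all_pos _) => e ->.
rewrite all_map; congr (nat_of_bool _)%:R; apply: eq_in_all => q /ts tq /=.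
rewrite (fun_if ev) mp_eval_opp !mp_eval_lead // -signr_odd (eqP tq).
case Dq: (size q) => [|n] /=; last by case: odd; rewrite ?mul1r ?expr1 ?mulN1r.
by rewrite (size0nil Dq) up_eval_nil lead_coef0 oppr0 mulr0.
Qed.

Lemma outcome_count_solutions p s :
  outcome y (count_solutions p s) (fun n => 0 < n <->
    exists2 x, root (eu p) x & all (fun q => 0 < (eu q).[x]) s).
Proof.
apply: outcome_bind (outcome_trim y p) _ => p' [tp' <-].
case: ifP => [/eqP p_0|/negbT]; last first.
  rewrite -lt0n => p_gt0.
  apply: outcome_imp (outcome_sum_queries _ tp') => n ->.
  exact: (sum_products_gt0 _ tp' p_gt0).2.
rewrite (size0nil p_0) up_eval_nil.
apply: outcome_bind (outcome_trim_all s) _ => t [tt Et].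
have all_t (f : pred {poly R}) : all (fun q => f (eu q)) t = all (fun q => f (eu q)) s.
  by rewrite -(all_map eu f t) Et all_map.
apply: outcome_bind (outcome_pos_pinfty tt) _ => _ ->.
apply: outcome_bind (outcome_pos_minfty tt) _ => _ ->.
apply: outcome_bind (outcome_trim y _) _ => d [td Ed].
apply: outcome_bind (outcome_sum_queries _ td) _ => _ ->.
apply: outcome_ret; move: Ed; rewrite up_eval_deriv up_eval_prod.
set sq := map eu t.
have -> : \prod_(q <- t) eu q = \prod_(q <- sq) q by rewrite big_map.
rewrite -/(bounding_poly sq) => Ed.
have all_sq (f : pred {poly R}) :
    \big[andb/true]_(q <- sq) f q = all (fun q => f (eu q)) t.
  by rewrite big_map big_all.
set S := \sum_(_ <- _) _; set a := all _ t; set b := all _ t.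
(* If all q are positive somewhere, they are so near an infinity or, by Rolle's theorem between two
   roots of the product, at a root of its derivative, which is [bounding_poly]. *)
have bnd := bounding_polyP sq; rewrite !all_sq -/a -/b in bnd.
have S_ge0 : 0 <= S.
  rewrite /S sum_taq_products sumr_ge0 // => x _.
  exact: (prod_sgr_gt0 t x).1.
split.
  have [a_t|a_f] := boolP a; [|have [b_t|b_f] := boolP b].
  - move=> _; have [|x] := bnd.1; first exact: Or31.
    by rewrite all_sq (all_t (fun q => 0 < q.[x])) => ?; exists x; rewrite ?root0.
  - move=> _; have [|x] := bnd.1; first exact: Or32.
    by rewrite all_sq (all_t (fun q => 0 < q.[x])) => ?; exists x; rewrite ?root0.
  (* With [d] empty, S would be 0, since [rootsR 0] is empty. *)
  rewrite !add0r => S_gt0; have [d_0|d_gt0] := posnP (size d).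
    by move: S_gt0; rewrite /S sum_taq_products (size0nil d_0) up_eval_nil
      rootsR0 big_nil ltxx.
  have [x _ sx] := (sum_products_gt0 t td d_gt0).2.1 S_gt0.
  by exists x; rewrite ?root0 // -(all_t (fun q => 0 < q.[x])).
move=> [x _]; rewrite -(all_t (fun q => 0 < q.[x])) => sx.
suff: [\/ a, b | 0 < S].
  case=> [->|->|S_gt0].
  - by rewrite -addrA ltr_pwDl ?ltr01 // addr_ge0 ?ler0n.
  - by rewrite ltr_pwDl // ltr_wpDl ?ltr01 ?ler0n.
  - by rewrite ltr_wpDl // addr_ge0 ?ler0n.
have [|?|?|[z /andP[/eqP Bz]]] := bnd.2; first by exists x; rewrite all_sq.
- exact: Or31.
- exact: Or32.
rewrite all_sq => sz; have [d_0|d_gt0] := posnP (size d); last first.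
  apply: Or33; apply/(sum_products_gt0 t td d_gt0).2; exists z => //.
  by rewrite Ed; apply/rootP.
(* Here the derivative is 0. The product is nonzero at x, hence a nonzero constant, and so is each
   factor; positive at x, it is positive at infinity. *)
apply: Or31; have prod0 : (\prod_(q <- sq) q).[x] != 0.
  rewrite horner_prod prodf_seq_neq0 all_map; apply/allP => q qt /=.
  by rewrite gt_eqF // (allP sx).
have: size (\prod_(q <- sq) q) == 1%N.
  rewrite eqn_leq derivn_poly0 derivn1 -/(bounding_poly sq) -Ed (size0nil d_0).
  rewrite up_eval_nil eqxx size_poly_gt0.
  by apply: contraNneq prod0 => ->; rewrite horner0.
move=> /size_prod_eq1 sq1; apply/allP => q qt.
have: 0 < (eu q).[x] by apply: (allP sx).
have /size_poly1P[k _ ->] : size (eu q) == 1%N.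
  by apply/eqP/sq1/map_f.
by rewrite hornerC lead_coefC.
Qed.

End Evaluation.

(** * Elimination of all variables *)

Definition update (y : var -> R) (v : var) (x : R) (u : var) : R :=
  if u == v then x else y u.

Lemma horner_univariate y v p x :
  (up_eval y (univariate v p)).[x] = mp_eval (update y v x) p.
Proof.
elim: p => [|[c w] p IH].
  by rewrite up_eval_nil horner0 mp_eval_nil.
rewrite /= up_eval_add hornerD IH mp_eval_cons /=; congr (_ + _).
elim: w => [|u w IHw] /=.
  by rewrite up_eval_cons up_eval_nil mul0r addr0 hornerC mp_eval_cons
    mp_eval_nil addr0 /= !big_nil.
rewrite big_cons [update y v x u]/update; case: ifP => _.
  by rewrite up_eval_shift hornerM hornerX IHw -mulrA [x * _]mulrC.
rewrite up_eval_scale hornerZ IHw mp_eval_cons mp_eval_nil addr0 mul1r /=.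
by rewrite big_seq1 mulrCA.
Qed.

(** Over the reals a sum of squares vanishes only if each square does, so all equations merge into
    one. *)
Lemma valid_split y (c : conditions R) :
  valid y c = (mp_eval y (sum_of_squares c) == 0) &&
              all (fun p => 0 < mp_eval y p) (positives c).
Proof.
have sq_ge0 c' : 0 <= mp_eval y (@sum_of_squares R c').
  rewrite mp_eval_flatten big_map sumr_ge0 // => t _.
  by case: t.2; rewrite ?mp_eval_nil // mp_eval_mul -expr2 sqr_ge0.
elim: c => [|[p b] c IH]; first by rewrite mp_eval_nil eqxx.
rewrite /= mp_eval_cat IH; case: b => /=; last first.
  by rewrite mp_eval_mul -expr2 (paddr_eq0 (sqr_ge0 _) (sq_ge0 _)) sqrf_eq0 andbA.
by rewrite mp_eval_nil add0r andbCA.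
Qed.

Lemma valid_eliminate y v c :
  has (valid y) (eliminate v c) <-> exists x, valid (update y v x) c.
Proof.
have [h H] := outcome_count_solutions y (univariate v (sum_of_squares c))
  [seq univariate v q | q <- @positives R c].
have sol x : root (up_eval y (univariate v (sum_of_squares c))) x &&
    all (fun q => 0 < (up_eval y q).[x]) [seq univariate v q | q <- positives c] =
    valid (update y v x) c.
  rewrite valid_split rootE horner_univariate all_map; congr (_ && _).
  by apply: eq_all => q /=; rewrite horner_univariate.
split=> [/hasP[d /flattenP[_ /mapP[b bm ->]]]|[x]].
  case: ifP => // b_gt0; rewrite inE => /eqP -> {d} /(H b bm) [+ _].
  by move=> /(_ b_gt0)[x rx px]; exists x; rewrite -sol rx.
rewrite -sol => /andP[rx px]; have /hasP[b bm vb] := h.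
have b_gt0 : 0 < b.2 by apply/(H b bm vb); exists x.
apply/hasP; exists b.1 => //; apply/flattenP; exists [:: b.1]; last exact: mem_head.
by apply/mapP; exists b => //; rewrite b_gt0.
Qed.

Lemma mp_eval0E p : mp_eval0 p = mp_eval (fun _ => 0 : R) p.
Proof.
elim: p => [|[c w] p IH]; first by rewrite mp_eval_nil.
rewrite mp_eval_cons /= IH; congr (_ + _).
case: w => [|v w] /=; first by rewrite big_nil mulr1.
by rewrite big_cons mul0r mulr0.
Qed.

Lemma holds0E c : holds0 c = valid (fun _ => 0 : R) c.
Proof.
elim: c => // -[p b] c IH; rewrite /= IH !mp_eval0E.
rewrite oppr_gt0; case: valid; rewrite ?andbF ?andbT //; case: b => //.
by case: ltrgtP.
Qed.

(** The fold eliminates the first variable last, so the induction peels off the outermost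
    elimination and keeps [y] arbitrary. *)
Lemma has_valid_eliminate_all y (d : seq (conditions R)) vs :
  has (valid y) (foldr (fun v d => flatten [seq eliminate v c | c <- d]) d vs)
  <-> exists2 y', {in [predC vs], y =1 y'} & has (valid y') d.
Proof.
elim: vs y => [|v vs IH] y /=.
  split=> [h|[y' E]]; first by exists y.
  suff -> : y = y' by []; apply/funext => u; exact: E.
have step D : has (valid y) (flatten [seq eliminate v c | c <- D]) <->
    exists x, has (valid (update y v x)) D.
  split=> [/hasP[e /flattenP[_ /mapP[c cD ->] ec] ve]|[x /hasP[c cD vc]]].
    have /valid_eliminate[x vx] : has (valid y) (eliminate v c).
      by apply/hasP; exists e.
    by exists x; apply/hasP; exists c.
  have /hasP[e ec ve] : has (valid y) (eliminate v c).
    by apply/valid_eliminate; exists x.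
  apply/hasP; exists e => //; apply/flattenP; exists (eliminate v c) => //.
  exact: map_f.
rewrite step; split=> [[x /IH[y' E vy']]|[y' E vy']].
  exists y' => // u; rewrite !inE negb_or => /andP[uv uvs].
  by rewrite -E // /update (negbTE uv).
exists (y' v); apply/IH; exists y' => // u uvs; rewrite /update.
by case: eqVneq => [->//|uv]; rewrite E // !inE negb_or uv.
Qed.

(** The remaining conditions are tested at the origin; this fixes the variables outside [vs] to be
    0. *)
Lemma satisfiableP (vs : seq var) (d : seq (conditions R)) :
  satisfiable vs d <->
  exists2 y : var -> R, {in [predC vs], forall v, y v = 0} & has (valid y) d.
Proof.
rewrite /satisfiable; set D := foldr _ d vs.
have -> : foldr (fun c b => if holds0 c then true else b) false D =
    has (valid (fun _ => 0 : R)) D.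
  by elim: D => //= c D ->; rewrite holds0E.
rewrite has_valid_eliminate_all.
by split=> -[y E vy]; exists y => // v /E.
Qed.

End Correctness.

(** * Models and weights of atoms *)

Lemma set_mem_cons (T : eqType) (x : T) (s : seq T) :
  [set` x :: s]%classic = (x |` [set` s])%classic.
Proof.
by apply/seteqP; split=> z /=; rewrite inE => /predU1P.
Qed.

Section Models.
Variable R : realType.

Section Atoms.
Variables (n : nat) (T : Type) (A : 'I_n -> set T).

(** The atoms are the fibres of the map from points to sign vectors; disjointness and covering both
    follow. *)
Lemma sign_atomP (a : signs n) t :
  sign_atom A a t <-> a = [ffun i => `[< A i t >]].
Proof.
split=> [at_t|->].
  apply/ffunP => i; rewrite ffunE; have := at_t i I.
  by case: (a i) => At; [rewrite asboolT | rewrite asboolF].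
by move=> i _; rewrite ffunE; case: asboolP.
Qed.

Lemma sign_atom_disjoint (a b : signs n) :
  a <> b -> (sign_atom A a `&` sign_atom A b = set0)%classic.
Proof.
move=> ab; apply/seteqP; split=> // t [/sign_atomP at_t /sign_atomP bt].
by apply: ab; rewrite at_t bt.
Qed.

Variables (F : set (set T)) (P : set T -> R).
Hypotheses (FP : basic_probability_space F P) (FU : setU_closed F)
  (FC : closed_under_complement F) (FA : forall i, F (A i))
  (addP : finitely_additive_on F P).

Lemma sign_atom_event (a : signs n) : F (sign_atom A a).
Proof.
have FI X Y : F X -> F Y -> F (X `&` Y)%classic.
  by move=> FX FY; rewrite -(setCK X) -(setCK Y) -setCU; do !apply: FC || apply: FU.
rewrite /sign_atom; set X := fun i => _.
have -> : [set: 'I_n]%classic = [set` enum 'I_n]%classic.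
  by apply/seteqP; split=> // i _ /=; rewrite mem_enum.
elim: (enum 'I_n) => [|i s IH].
  by rewrite set_nil bigcap_set0; apply: bps_eventT FP.
rewrite set_mem_cons bigcap_setU1; apply: FI => //.
by rewrite /X; case: (a i); [|apply: FC].
Qed.

Lemma prob_union_of_atoms (S : {set signs n}) :
  F (\bigcup_(a in [set` S]) sign_atom A a)%classic /\
  P (\bigcup_(a in [set` S]) sign_atom A a)%classic =
    \sum_(a in S) P (sign_atom A a).
Proof.
have -> : [set` S]%classic = [set` enum S]%classic.
  by apply/seteqP; split=> a /=; rewrite mem_enum.
rewrite -big_enum /=; have := enum_uniq S.
elim: (enum S) => [|a s IH] /=.
  rewrite set_nil bigcup_set0 big_nil.
  by split; [apply: bps_event0 FP | apply: bps_prob0 FP].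
move=> /andP[a_s /IH[Fs Ps]]; rewrite set_mem_cons bigcup_setU1 big_cons -Ps.
split; first by apply: FU => //; apply: sign_atom_event.
apply: addP => //; first exact: sign_atom_event.
rewrite setI_bigcupr bigcup0 // => b /= bs; apply: sign_atom_disjoint => ab.
by rewrite ab bs in a_s.
Qed.

Lemma prob_sign_atom_ge0 (a : signs n) : 0 <= P (sign_atom A a).
Proof.
rewrite -(bps_prob0 FP); apply: (bps_prob_le FP) => //.
  exact: bps_event0 FP.
exact: sign_atom_event.
Qed.

Lemma sum_prob_sign_atom : \sum_(a : signs n) P (sign_atom A a) = 1.
Proof.
transitivity (\sum_(a in [set: signs n]) P (sign_atom A a)).
  by apply: eq_bigl => a; rewrite finset.in_setT.
rewrite -(prob_union_of_atoms _).2 -(bps_probT FP); congr P; apply/seteqP; split=> // t _.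
exists [ffun i => `[< A i t >]]; first by rewrite /= finset.in_setT.
exact/sign_atomP.
Qed.

End Atoms.

Variables (n k : nat) (E : environment R n k) (Sigma : 'I_k -> {set signs n}).
Hypothesis SigmaP : forall j, union_of_atoms (combs E j) (Sigma j).

Lemma comb_prob_atom_sum (T : Type) (F : set (set T)) (P : set T -> R) A :
  is_model E F P A ->
  comb_prob E P A = atom_sum Sigma (fun a => P (sign_atom A a)).
Proof.
move=> M; apply/funext => j; rewrite /comb_prob SigmaP.
exact: (prob_union_of_atoms (model_bps M) (model_setU M) (model_setC M)
  (model_event M) (model_additive M) _).2.
Qed.

Definition weight (y : signs n -> R) (X : set (signs n)) : R :=
  \sum_(a | `[< X a >]) y a.

Definition coordinate_event (i : 'I_n) : set (signs n) := fun a => a i.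

(** Under [coordinate_event] the atom of a is the singleton {a}, so the points of B_j are the
    elements of [Sigma j]. *)
Lemma comb_prob_weight y :
  comb_prob E (weight y) coordinate_event = atom_sum Sigma y.
Proof.
apply/funext => j; rewrite /comb_prob SigmaP /weight /atom_sum.
apply: eq_bigl => a; apply/asboolP/idP => [[b /= bS /sign_atomP]|aS].
  move=> ba; suff <- : b = a by [].
  by rewrite ba; apply/ffunP => i; rewrite ffunE /coordinate_event asboolb.
exists a => //; apply/sign_atomP/ffunP => i.
by rewrite ffunE /coordinate_event asboolb.
Qed.

Lemma weight_model y :
  (forall r, satisfies (atom_sum Sigma y) (requirement (e := E) r)) ->
  \sum_a y a = 1 -> (forall a, 0 <= y a) ->
  is_model E setT (weight y) coordinate_event.
Proof.
move=> req sum1 y_ge0; split=> //.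
- split=> // [||X Y _ _ XY].
  + by rewrite /weight big_pred0 // => a; apply/asboolF.
  + by rewrite /weight -sum1; apply: eq_bigl => a; apply/asboolT.
  (* Monotonicity: the sum over Y splits into the sum over X and a nonnegative rest. *)
  rewrite /weight [leRHS](bigID (fun a => `[< X a >])) /= -[leLHS]addr0 lerD //.
    rewrite le_eqVlt; apply/orP; left; apply/eqP; apply: eq_bigl => a.
    by apply/asboolP/andP => [Xa|[_ /asboolP]] //; split; apply/asboolP => //; apply: XY.
  by apply: sumr_ge0.
- move=> X Y _ _ XY; rewrite /weight (bigID (fun a => `[< X a >])) /=.
  congr (_ + _); apply: eq_bigl => a.
    by apply/andP/asboolP => [[_ /asboolP]|Xa] //; split; apply/asboolP => //; left.
  apply/andP/asboolP => [[/asboolP[Xa|//] /asboolP]|Ya] //.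
  split; apply/asboolP; first by right.
  by move=> Xa; rewrite -[False]/(set0 a) -XY.
- by move=> r; rewrite comb_prob_weight.
Qed.

Lemma necessary_consequence_iff (g : prob_relation R k) :
  necessary_consequence E g <->
  ~ exists y : signs n -> R,
      [/\ forall r : 'I_(num_requirements E),
            satisfies (atom_sum Sigma y) (requirement r),
          \sum_(a : signs n) y a = 1,
          forall a : signs n, 0 <= y a
        & ~ satisfies (atom_sum Sigma y) g].
Proof.
split=> [nec [y [req sum1 y_ge0]]|nsol T F P A M].
  by apply; rewrite -comb_prob_weight; apply: nec (weight_model req sum1 y_ge0).
apply: contrapT => ng; apply: nsol; exists (fun a => P (sign_atom A a)).
have cE := comb_prob_atom_sum M; rewrite -cE; split=> //.
- exact: model_requirements M.
- exact: (sum_prob_sign_atom (model_bps M) (model_setU M) (model_setC M)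
    (model_event M) (model_additive M)).
- exact: (prob_sign_atom_ge0 (model_bps M) (model_setU M) (model_setC M)
    (model_event M)).
Qed.

End Models.

(** * The procedure on encoded problems *)

Section Encoded.
Variable R : realType.

(** The name of the variable y_a. *)
Definition sign_seq (n : nat) (a : signs n) : var := [seq a i | i <- enum 'I_n].

Lemma nth_sign_seq n (a : signs n) (i : 'I_n) : nth false (sign_seq a) i = a i.
Proof. by rewrite (nth_map i) ?size_enum_ord // nth_ord_enum. Qed.

Lemma size_sign_seq n (a : signs n) : size (sign_seq a) = n.
Proof. by rewrite size_map size_enum_ord. Qed.

Lemma sign_seq_inj n : injective (@sign_seq n).
Proof. by move=> a b ab; apply/ffunP => i; rewrite -!nth_sign_seq ab. Qed.

Lemma sign_seq_nth n v : size v = n ->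
  sign_seq [ffun i : 'I_n => nth false v i] = v.
Proof.
move=> sv; apply: (@eq_from_nth _ false); rewrite size_sign_seq // => i lt_in.
by rewrite -[i]/(nat_of_ord (Ordinal lt_in)) nth_sign_seq ffunE.
Qed.

Lemma mem_sign_vectors n v : (v \in sign_vectors n) = (size v == n).
Proof.
elim: n v => [|n IH] v; first by rewrite inE size_eq0.
rewrite /= -/(sign_vectors n) mem_cat; case: v => [|b v].
  by apply/negbTE; rewrite negb_or; apply/andP; split; apply/mapP => -[].
rewrite eqSS -IH; have inj c : injective (cons c : var -> var) by move=> ? ? [].
have no c d (s : seq var) : c != d -> (c :: v \in [seq d :: a | a <- s]) = false.
  by move=> cd; apply/negbTE/mapP => -[a _ [E]]; rewrite E eqxx in cd.
by case: b; rewrite mem_map ?no ?orbF.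
Qed.

Lemma uniq_sign_vectors n : uniq (sign_vectors n).
Proof.
elim: n => // n IH; rewrite /= -/(sign_vectors n) cat_uniq.
have inj c : injective (cons c : var -> var) by move=> ? ? [].
rewrite !map_inj_uniq // IH andbT /=.
by apply/hasPn => _ /mapP[a _ ->]; apply/mapP => -[].
Qed.

Lemma big_sign_vectors n (p : pred var) (F : var -> R) :
  \sum_(v <- sign_vectors n | p v) F v =
  \sum_(a : signs n | p (sign_seq a)) F (sign_seq a).
Proof.
transitivity (\sum_(v <- [seq sign_seq a | a <- enum {: signs n}] | p v) F v);
  last by rewrite big_map big_enum_cond.
apply: perm_big; apply: uniq_perm.
- exact: uniq_sign_vectors.
- by rewrite map_inj_uniq ?enum_uniq //; apply: sign_seq_inj.
move=> v; rewrite mem_sign_vectors; apply/eqP/mapP => [sv|[a _ ->]].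
  by exists [ffun i : 'I_n => nth false v i]; rewrite ?mem_enum // sign_seq_nth.
exact: size_sign_seq.
Qed.

(** The choice of the sets Sigma_j that the procedure makes; the decidability statement supplies
    none. *)
Definition comb_signs n (b : bool_comb n) : {set signs n} :=
  [set a | eval_comb b (sign_seq a)].

Lemma comb_signsP n (b : bool_comb n) : union_of_atoms b (comb_signs b).
Proof.
(* Membership of t depends only on its sign vector. *)
move=> T A; have key t : event_of A b t <->
    eval_comb b (sign_seq [ffun i => `[< A i t >]]).
  elim: b => /= [i|b IH|b IHb c IHc|b IHb c IHc].
  - by rewrite nth_sign_seq ffunE; split=> /asboolP.
  - by rewrite IH; split=> /negP.
  - by rewrite IHb IHc; split=> /orP.
  - by rewrite IHb IHc; split=> /andP.
apply/seteqP; split=> t.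
  by move=> /key bt; exists [ffun i => `[< A i t >]]; [rewrite /= inE|apply/sign_atomP].
by case=> a /=; rewrite inE => ba /sign_atomP at_t; apply/key; rewrite -at_t.
Qed.

Section Environment.
Variables (n k : nat) (E : environment R n k).

(** Typed counterpart of [enc_relation], on which the computability rules can act; its code is the
    value of [enc_relation]. *)
Definition code_of_relation (r : prob_relation R k) : nat * seq (R * seq nat) :=
  (match rel_symbol r with EqZero => 0 | NeqZero => 1 | GeZero => 2 end%N,
   [seq (mcoeff m (rel_poly r), [seq m i | i <- enum 'I_k])
   | m <- msupp (rel_poly r)]).

Definition codes_of_combs : seq {n : nat & bool_comb n} :=
  [seq existT _ n (combs E j) | j <- enum 'I_k].

Variables (vs : seq var) (y : var -> R) (xs : seq (mp R)).

Lemma has_dnf_and (d d' : seq (conditions R)) :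
  has (valid y) (dnf_and d d') = has (valid y) d && has (valid y) d'.
Proof.
apply/hasP/andP => [[_ /flattenP[_ /mapP[c cd ->] /mapP[c' c'd' ->]]]|].
  by rewrite /valid all_cat => /andP[? ?]; split; apply/hasP; [exists c|exists c'].
case=> /hasP[c cd vc] /hasP[c' cd' vc']; exists (c ++ c').
  by apply/flattenP; exists [seq c ++ c' | c' <- d']; apply: map_f.
by rewrite /valid all_cat; apply/andP.
Qed.

Lemma mp_eval_substitute (r : prob_relation R k) :
  mp_eval y (substitute xs (code_of_relation r).2) =
  meval (fun j : 'I_k => mp_eval y (nth [::] xs j)) (rel_poly r).
Proof.
rewrite mp_eval_flatten big_map big_map mevalE; apply: eq_bigr => m _ /=.
rewrite mp_eval_mul mp_eval_cons mp_eval_nil big_nil mulr1 addr0 /=.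
congr (_ * _); rewrite size_map size_enum_ord.
transitivity (\prod_(j <- iota 0 k)
    mp_eval y (nth [::] xs j) ^+ nth 0%N [seq m i | i <- enum 'I_k] j).
  elim: (iota 0 k) => [|j s IH]; first by rewrite big_nil mp_eval_one.
  rewrite big_cons -IH /=; elim: (nth _ _ j) => [|e IHe] /=; first by rewrite mul1r.
  by rewrite mp_eval_mul IHe exprS mulrA.
rewrite -{1}[k]subn0 -/(index_iota 0 k) big_mkord; apply: eq_bigr => j _.
by rewrite (nth_map j) ?size_enum_ord // nth_ord_enum.
Qed.

Lemma relation_dnfP (r : prob_relation R k) :
  has (valid y) (relation_dnf xs (code_of_relation r)) <->
  satisfies (fun j => mp_eval y (nth [::] xs j)) r.
Proof.
rewrite /satisfies -mp_eval_substitute /relation_dnf; set g := substitute _ _.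
rewrite /code_of_relation; case: rel_symbol; rewrite /= /valid /= ?mp_eval_opp
  ?oppr_gt0 ?andbT ?orbF.
- by split=> /eqP.
- by rewrite orbC -neq_lt; split=> /eqP.
- by rewrite orbC eq_sym -le_eqVlt.
Qed.

Lemma negation_dnfP (r : prob_relation R k) :
  has (valid y) (negation_dnf xs (code_of_relation r)) <->
  ~ satisfies (fun j => mp_eval y (nth [::] xs j)) r.
Proof.
rewrite /satisfies -mp_eval_substitute /negation_dnf; set g := substitute _ _.
rewrite /code_of_relation; case: rel_symbol; rewrite /= /valid /= ?mp_eval_opp
  ?oppr_gt0 ?andbT ?orbF.
- by rewrite orbC -neq_lt; split=> /eqP.
- by split=> [/eqP ? //|/contrapT ->].
- by rewrite ltNge; split=> /negP.
Qed.

Lemma simplex_dnfP :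
  has (valid y) (simplex_dnf R vs) <->
  \sum_(v <- vs) y v = 1 /\ all (fun v => 0 <= y v) vs.
Proof.
have nonneg (d : seq (conditions R)) (ws : seq var) :
    has (valid y) (foldr (fun a d => dnf_and
      [:: [:: ([:: (1, [:: a])], true)]; [:: ([:: (1, [:: a])], false)]] d) d ws) =
    has (valid y) d && all (fun v => 0 <= y v) ws.
  elim: ws => [|v ws IH]; first by rewrite andbT.
  rewrite has_dnf_and IH /= /valid /= !andbT !orbF.
  rewrite mp_eval_cons mp_eval_nil addr0 mul1r big_seq1 /=.
  by rewrite orbC eq_sym -le_eqVlt andbCA.
rewrite nonneg /valid /= !andbT orbF mp_eval_cons big_nil mulr1 addrC subr_eq0.
rewrite /mp_eval big_map; under eq_bigr do rewrite big_seq1 mul1r.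
by split=> [/andP[/eqP]|[/eqP-> ->]].
Qed.

Lemma counterexample_dnfP (r : prob_relation R k) :
  has (valid y) (counterexample_dnf vs xs
    [seq code_of_relation (requirement (e := E) i)
    | i <- enum 'I_(num_requirements E)] (code_of_relation r)) <->
  let x (j : 'I_k) := mp_eval y (nth [::] xs j) in
  [/\ forall i, satisfies x (requirement (e := E) i), \sum_(v <- vs) y v = 1,
      all (fun v => 0 <= y v) vs & ~ satisfies x r].
Proof.
rewrite /counterexample_dnf has_dnf_and /=; set x := fun j : 'I_k => _.
have step (s : seq 'I_(num_requirements E)) :
    has (valid y) (foldr (fun q d => dnf_and (relation_dnf xs q) d)
      (simplex_dnf R vs) [seq code_of_relation (requirement i) | i <- s]) <->
    (forall i, i \in s -> satisfies x (requirement i)) /\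
    \sum_(v <- vs) y v = 1 /\ all (fun v => 0 <= y v) vs.
  elim: s => [|q s IH] /=; first by rewrite simplex_dnfP; split=> [|[]].
  rewrite has_dnf_and; split=> [/andP[/relation_dnfP sq /IH[ss s1]]|[ss s1]].
    by split=> // i; rewrite inE => /predU1P[-> //|]; apply: ss.
  apply/andP; split; first by apply/relation_dnfP/ss/mem_head.
  by apply/IH; split=> // i i_s; apply: ss; rewrite inE i_s orbT.
split=> [/andP[/negation_dnfP nr /step[srs [s1 p]]]|[srs s1 p nr]].
  by split=> // i; apply: srs; rewrite mem_enum.
by apply/andP; split; [apply/negation_dnfP|apply/step].
Qed.

End Environment.

End Encoded.

(** * Correctness of the decision program *)

Section Decision.
Variables (R : realType) (n k : nat) (E : environment R n k).
Variable g : prob_relation R k.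

(** Nested pairs replace the list of [enc_problem], whose entries have different types; the final
    [tt] is coded by the [VNil] that ends this list. *)
Definition code_of_problem :=
  (n, (k, (codes_of_combs E,
    ([seq code_of_relation (requirement (e := E) i)
     | i <- enum 'I_(num_requirements E)], (code_of_relation g, tt))))).

Lemma enc_code_of_problem : enc code_of_problem = enc_problem E g.
Proof.
have encR (r : prob_relation R k) :
    enc (code_of_relation r) = enc_relation r :> value R.
  rewrite /enc_relation /enc_poly /code_of_relation; congr VPair.
    by case: rel_symbol.
  rewrite /= /enc /encodable_seq -map_comp; congr enc_seq; apply: eq_map => m.
  by rewrite /= /enc /encodable_prod /= /enc /encodable_seq -map_comp.
rewrite /enc_problem -encR /code_of_problem /enc /encodable_prod /=.
rewrite /enc /encodable_seq -!map_comp.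
do 3!congr VPair; congr VPair; congr (enc_seq _); apply: eq_map => i /=.
exact: encR.
Qed.

Lemma mp_eval_comb_mp y (vs : seq (seq bool)) b :
  mp_eval y (comb_mp R vs b) = \sum_(v <- vs | eval_comb_code b v) y v.
Proof.
rewrite mp_eval_flatten big_map [RHS]big_mkcond; apply: eq_bigr => v _.
by case: ifP => _; rewrite ?mp_eval_nil // mp_eval_cons mp_eval_nil addr0 mul1r
  big_seq1.
Qed.

Lemma satisfiable_counterexample :
  satisfiable (sign_vectors n) (counterexample_dnf (sign_vectors n)
    [seq comb_mp R (sign_vectors n) b | b <- codes_of_combs E]
    [seq code_of_relation (requirement (e := E) i)
    | i <- enum 'I_(num_requirements E)] (code_of_relation g)) <->
  exists y : signs n -> R,
    [/\ forall r : 'I_(num_requirements E),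
          satisfies (atom_sum (fun j => comb_signs (combs E j)) y) (requirement r),
        \sum_(a : signs n) y a = 1,
        forall a : signs n, 0 <= y a
      & ~ satisfies (atom_sum (fun j => comb_signs (combs E j)) y) g].
Proof.
set vs := sign_vectors n; set xs := [seq comb_mp R vs b | b <- _].
pose Sigma j := comb_signs (combs E j); rewrite -/Sigma.
have xE y : (fun j : 'I_k => mp_eval y (nth [::] xs j)) =
    atom_sum Sigma (fun a => y (sign_seq a)) :> ('I_k -> R).
  apply/funext => j; rewrite /xs /codes_of_combs -map_comp.
  rewrite (nth_map j) ?size_enum_ord // nth_ord_enum mp_eval_comb_mp.
  by rewrite big_sign_vectors; apply: eq_bigl => a; rewrite inE.
rewrite satisfiableP; split=> [[y _ /counterexample_dnfP[]]|].
  rewrite xE => req sum1 y_ge0 ng; exists (fun a => y (sign_seq a)); split=> //.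
    by rewrite -sum1 big_sign_vectors.
  by move=> a; apply: (allP y_ge0); rewrite mem_sign_vectors size_sign_seq.
case=> y [req sum1 y_ge0 ng].
(* Lists of other lengths name no variable and get the default 0, as [satisfiableP] demands. *)
pose y' v := if size v == n then y [ffun i : 'I_n => nth false v i] else 0.
have y'E : (fun a => y' (sign_seq a)) = y.
  apply/funext => a; rewrite /y' size_sign_seq eqxx; congr y.
  by apply/ffunP => i; rewrite ffunE nth_sign_seq.
exists y'.
  by move=> v; rewrite inE mem_sign_vectors /y' => /negbTE ->.
apply/counterexample_dnfP; rewrite /= xE y'E; split=> //.
- by rewrite big_sign_vectors -sum1 -y'E.
- by apply/allP => v _; rewrite /y'; case: ifP.
Qed.

Lemma no_counterexampleP :
  no_counterexample code_of_problem =
  if `[< necessary_consequence E g >] then 1 else 0 :> R.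
Proof.
have nec := necessary_consequence_iff (fun j => comb_signsP (combs E j)) g.
rewrite /no_counterexample; case: ifP => [/satisfiable_counterexample sol|unsat].
  by rewrite asboolF // => /nec; apply.
by rewrite asboolT //; apply/nec => /satisfiable_counterexample; rewrite unsat.
Qed.

End Decision.

Theorem corollary3p3 (R : realType) :
  (forall (n k : nat) (E : environment R n k) (g : prob_relation R k)
      (Sigma : 'I_k -> {set signs n}),
    consistent E ->
    (forall j : 'I_k, union_of_atoms (combs E j) (Sigma j)) ->
    (necessary_consequence E g <->
     ~ exists y : signs n -> R,
         [/\ forall r : 'I_(num_requirements E),
               satisfies (atom_sum Sigma y) (requirement r),
             \sum_(a : signs n) y a = 1,
             forall a : signs n, 0 <= y a
           & ~ satisfies (atom_sum Sigma y) g])) /\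
  (exists p : program,
    forall (n k : nat) (E : environment R n k) (g : prob_relation R k),
      consistent E ->
      answers p (enc_problem E g) (necessary_consequence E g)).
Proof.
split=> [n k E g Sigma _ SigmaP|]; first exact: necessary_consequence_iff.
(* [n] and [k] belong to the input, so a single program precedes all quantifiers over problems. *)
have [p Hp] := @computable1P R _ _ _ _ _ (computable_no_counterexample R).
exists p => n k E g _; rewrite -enc_code_of_problem.
have := Hp (code_of_problem E g) [:: enc (code_of_problem E g)] (conj erefl I).
rewrite no_counterexampleP => run_p.
by split=> nec; move: run_p; rewrite ?(asboolT nec) ?(asboolF nec).
Qed.
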